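(* Let $T>0$, $x_0\in\mathbb{R}$, and let $W_t$ be a standard Brownian motion. For each choice of sign $\pm$, consider the Markov diffusion process solving the stochastic differential equation $$dX_t = f_{\pm}(X_t,t)\,dt + dW_t,\qquad X_0=x_0,\qquad t\in[0,T),\qquad f_{\pm}(x,t):=\partial_x \ln\left[\Phi\left(\frac{\pm x}{\sqrt{T-t}}\right)\right].$$ Then this process has transition probability density (from position $x_0$ at time $0$ to position $x$ at time $t\in(0,T)$) given by $$p_{\pm}(x,t\mid x_0,0)=\frac{e^{-\frac{(x-x_0)^2}{2t}}}{\sqrt{2\pi t}}\;\frac{\Phi\left(\frac{\pm x}{\sqrt{T-t}}\right)}{\Phi\left(\frac{\pm x_0}{\sqrt{T}}\right)}=\frac{1}{\sqrt t}\,ESK\left(\sqrt{\tfrac{t}{T-t}},\ \pm\tfrac{x_0}{\sqrt t};\ \pm\tfrac{x}{\sqrt t}\right),\qquad x\in\mathbb{R}.$$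
   Context: Here $\phi(x)=\frac{1}{\sqrt{2\pi}}e^{-x^2/2}$ and $\Phi(x)=\int_{-\infty}^x\phi(s)\,ds$ are the standard normal density and distribution function. The extended skew-normal density with parameters $\eta,x_0\in\mathbb{R}$ is $$ESK(\eta,x_0;x)=\phi(x-x_0)\,\frac{\Phi(\eta x)}{\Phi\left(\frac{\eta x_0}{\sqrt{1+\eta^2}}\right)},\qquad x\in\mathbb{R}.$$ The transition probability density $p_\pm(\cdot,t\mid x_0,0)$ is the probability density of $X_t$ given $X_0=x_0$. *)

(* Defs.v *)
From HB Require Import structures.
From mathcomp Require Import all_boot all_order all_algebra.
From mathcomp Require Import all_classical all_reals all_analysis.

Set Implicit Arguments.
Unset Strict Implicit.
Unset Printing Implicit Defensive.
Import Order.TTheory GRing.Theory Num.Theory.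
Import numFieldNormedType.Exports.

Local Open Scope classical_set_scope.
Local Open Scope ring_scope.

Section normal_functions.
Context {R : realType}.

Definition phi (x : R) : R := normal_pdf 0 1 x.

Definition Phi (x : R) : R :=
  \int[@lebesgue_measure R]_(s in `]-oo, x]) phi s.

Definition ESK (eta x0 x : R) : R :=
  phi (x - x0) * (Phi (eta * x) / Phi (eta * x0 / Num.sqrt (1 + eta ^+ 2))).

(* The sign +/- is encoded by [b : bool] through the factor [(-1) ^+ b]:
   [b = false] is the sign +, [b = true] is the sign -. *)
Definition drift (b : bool) (T x t : R) : R :=
  derive1 (fun y : R => ln (Phi ((-1) ^+ b * y / Num.sqrt (T - t)))) x.

Definition transition_pdf (b : bool) (T x0 t x : R) : R :=
  expR (- ((x - x0) ^+ 2 / (2 * t))) / Num.sqrt (2 * pi * t) *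
  (Phi ((-1) ^+ b * x / Num.sqrt (T - t)) /
   Phi ((-1) ^+ b * x0 / Num.sqrt T)).

End normal_functions.

(* Processes and filtrations are total functions of a real time; values at
   times outside [0, +oo[ (or [0, T[ for the solution of the SDE) are never
   constrained. *)
Section stochastic_processes.
Context {R : realType} {d : measure_display} {Omega : measurableType d}.
Variable P : probability Omega R.

Record filtration (F : R -> set (set Omega)) : Prop := {
  filtration_sigma_algebra : forall t, 0 <= t -> sigma_algebra setT (F t) ;
  filtration_measurable : forall t, 0 <= t -> F t `<=` measurable ;
  filtration_le : forall s t, 0 <= s -> s <= t -> F s `<=` F t }.

Definition adapted (F : R -> set (set Omega)) (I : set R)
    (X : R -> Omega -> R) : Prop :=
  forall t, I t -> forall B : set R, measurable B -> F t (X t @^-1` B).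

Definition increment (W : R -> Omega -> R) (s t : R) : Omega -> R :=
  fun w => W t w - W s w.

Record brownian_motion (F : R -> set (set Omega)) (W : R -> Omega -> R)
    : Prop := {
  brownian_adapted : adapted F `[0, +oo[ W ;
  brownian_start : {ae P, forall w, W 0 w = 0} ;
  brownian_continuous :
    {ae P, forall w, {within `[0, +oo[, continuous (fun t : R => W t w)}} ;
  brownian_gaussian : forall s t, 0 <= s -> s < t ->
    forall B : set R, measurable B ->
    P (increment W s t @^-1` B) = normal_prob 0 (Num.sqrt (t - s)) B ;
  brownian_independent : forall s t, 0 <= s -> s < t ->
    forall A, F s A -> forall B : set R, measurable B ->
    P (A `&` increment W s t @^-1` B) =
    (P A * P (increment W s t @^-1` B))%E }.

(* Solution on [0, T[ of dX_t = f(X_t, t) dt + dW_t, X_0 = x0. The diffusion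
   coefficient is 1, so that the stochastic integral of the integral form of
   the equation is W_t - W_0 = W_t. *)
Record sde_solution (F : R -> set (set Omega)) (W : R -> Omega -> R)
    (f : R -> R -> R) (T x0 : R) (X : R -> Omega -> R) : Prop := {
  solution_adapted : adapted F `[0, T[ X ;
  solution_start : {ae P, forall w, X 0 w = x0} ;
  solution_continuous :
    {ae P, forall w, {within `[0, T[, continuous (fun t : R => X t w)}} ;
  solution_integrable : {ae P, forall w, forall t : R, 0 <= t < T ->
    (@lebesgue_measure R).-integrable `[0, t]
      (fun s : R => (f (X s w) s)%:E)} ;
  solution_equation : {ae P, forall w, forall t : R, 0 <= t < T ->
    X t w = x0 + (\int[@lebesgue_measure R]_(s in `[0, t]) f (X s w) s)
            + W t w} }.

Record has_density (Y : Omega -> R) (p : R -> R) : Prop := {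
  density_measurable : measurable_fun setT p ;
  density_ge0 : forall x, 0 <= p x ;
  density_law : forall B : set R, measurable B ->
    P (Y @^-1` B) = (\int[@lebesgue_measure R]_(x in B) (p x)%:E)%E }.

End stochastic_processes.

(* Main.v *)
(* The drift is the logarithmic derivative of
   h(s, x) = Phi(+-x / sqrt(T - s)), a space-time harmonic function of Brownian
   motion, so X is a Doob transform. For t < a < T and a centre m, the kernel
   v(s, x) = exp(-(x - m)^2 / (2 (a - s))) / sqrt(2 pi (a - s)) is space-time
   harmonic too, and u = v / h is bounded. Then E u(t, X_t) = u(0, x0): on a fine
   grid the Euler scheme driven by the increments of W changes the expectation
   of u by o(step) at each step, as long as the path stays in a compact set,
   and boundedness of u controls the paths which escape. No Ito calculus is
   needed.
   Integrating the identity against h(t, m) dm over an open set O and letting a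
   decrease to t gives P(X_t in O) <= int_O p, where p is the claimed density.
   Outer regularity extends the inequality to Borel sets, and it is an
   equality because both sides have total mass one. *)
Require Import Defs.
From HB Require Import structures.
From mathcomp Require Import all_boot all_order all_algebra.
From mathcomp Require Import all_classical all_reals all_analysis.
From mathcomp Require Import measurable_realfun.
From mathcomp Require Import ring lra.
Import Order.TTheory GRing.Theory Num.Theory.
Import numFieldNormedType.Exports.
Local Open Scope classical_set_scope.
Local Open Scope ring_scope.

Set Implicit Arguments.
Unset Strict Implicit.
Unset Printing Implicit Defensive.

(** * Centred Gaussian measures *)

(** The drift is unbounded: it grows linearly on the side where h vanishes. So the local error is
    estimated on compact sets only, and two errors of different nature have to be separated. The
    Gaussian error of one Euler step is at most a constant times dt^(3/2) on a compact set, hence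
    O(sqrt dt) over the t/dt steps. It is this small because u h = v gives v'' = u'' h + 2 u' h' + u
    h'': with drift h'/h, the terms of order dt cancel exactly. The distance between the path and
    its own Euler step is o(dt), but from a fineness on that depends on the path. Dominated
    convergence turns this into an event of small probability, and bounded u makes that event cheap.
    The kernel needs a > t, so that u is smooth up to time t included, and a < T, so that u is
    bounded. When a decreases to t, only a lower bound is taken from the regularised indicator of O.
    It uses the continuity of h at points of O and says nothing about the boundary of O; this is why
    an inequality on open sets comes first. *)

Section bounded_functions.
Context d (T : measurableType d) (R : realType) (P : probability T R).
Implicit Types (f : T -> R) (M : R).

Lemma bounded_integrable f M : measurable_fun setT f ->
  (forall x, `|f x| <= M) -> P.-integrable setT (EFin \o f).
Proof.
move=> mf fM; apply: measurable_bounded_integrable => //.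
  by rewrite [X in (X < _)%E]probability_setT ltry.
by exists M; split; rewrite ?num_real// => r Mr x _ /=; rewrite (le_trans (fM
  x))// ltW.
Qed.

Lemma Rintegral_le_bound f M : measurable_fun setT f ->
  (forall x, `|f x| <= M) -> `|\int[P]_x f x| <= M.
Proof.
move=> mf fM; have fi := bounded_integrable mf fM.
apply: (le_trans (le_normr_Rintegral _ fi)) => //.
have -> : M = \int[P]_x M.
  by rewrite Rintegral_cst// [X in fine X]probability_setT mulr1.
apply: le_Rintegral => //.
  by apply: (@bounded_integrable _ M); [exact: measurableT_comp|
    move=> x; rewrite normr_id].
by apply: (@bounded_integrable _ `|M|).
Qed.

End bounded_functions.

(** The parameter is the variance, because variances are elapsed times here and add up under
    convolution. For [v <= 0] the square root and its inverse are 0, so [gauss v] is the zero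
    function. *)
Definition gauss {R : realType} (v y : R) : R :=
  expR (- (y ^+ 2 / (2 * v))) / Num.sqrt (2 * pi * v).

Notation gauss_prob v := (normal_prob 0 (Num.sqrt v)).

Section gauss_density.
Context {R : realType}.
Implicit Types (v x y m : R).
Local Notation mu := (@lebesgue_measure R).

Lemma normal_pdf_gauss v m y : 0 < v ->
  normal_pdf m (Num.sqrt v) y = gauss v (y - m).
Proof.
move=> v0; rewrite normal_pdfE ?gt_eqF ?sqrtr_gt0// /normal_peak /normal_fun.
rewrite sqr_sqrtr ?ltW// mulrC /gauss; congr (expR _ / Num.sqrt _).
  by rewrite -mulr_natl mulNr.
by rewrite -mulr_natl; ring.
Qed.

Lemma gauss_gt0 v y : 0 < v -> 0 < gauss v y.
Proof.
move=> v0; rewrite divr_gt0 ?expR_gt0// sqrtr_gt0.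
by rewrite !mulr_gt0 ?pi_gt0.
Qed.

Lemma gauss_ge0 v y : 0 <= gauss v y.
Proof. by rewrite divr_ge0 ?expR_ge0 ?sqrtr_ge0. Qed.

Lemma gaussN v y : gauss v (- y) = gauss v y.
Proof. by rewrite /gauss sqrrN. Qed.

Lemma continuous_gauss v : continuous (gauss v).
Proof.
move=> y; apply: cvgMr_tmp; apply: (cvg_comp _ expR); last exact:
  continuous_expR.
apply: cvgN; apply: cvgMr_tmp; exact: exprn_continuous.
Qed.

Lemma measurable_gauss v : measurable_fun setT (gauss v).
Proof. by apply: continuous_measurable_fun; exact: continuous_gauss. Qed.

Lemma integral_gauss v m : 0 < v -> (\int[mu]_y (gauss v (y - m))%:E = 1)%E.
Proof.
move=> v0; rewrite -[RHS](integral_normal_pdf m (Num.sqrt v)).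
by apply: eq_integral => y _; rewrite normal_pdf_gauss.
Qed.

Lemma gauss_probE v A : 0 < v ->
  gauss_prob v A = (\int[mu]_(y in A) (gauss v y)%:E)%E.
Proof.
by move=> v0; apply: eq_integral => y _; rewrite normal_pdf_gauss// subr0.
Qed.

Lemma integral_gauss_prob v (f : R -> \bar R) : 0 < v ->
  (gauss_prob v).-integrable setT f ->
  (\int[gauss_prob v]_y f y = \int[mu]_y (f y * (gauss v y)%:E))%E.
Proof.
move=> v0 fi; have Nmu := @normal_prob_dominates R 0 (Num.sqrt v).
have mf := measurable_int _ fi.
rewrite -(Radon_Nikodym_change_of_variables Nmu)//=.
apply: ae_eq_integral => //.
- exact: emeasurable_funM.
- by apply: emeasurable_funM => //; apply/measurable_EFinP; exact:
  measurable_gauss.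
(* The Radon-Nikodym derivative is an abstract choice. Its integrals over all measurable sets
   identify it with [gauss v] almost everywhere. *)
- apply: ae_eqe_mul2l => /=.
  rewrite Radon_NikodymE//=.
  case: cid => /= h [h1 h2 h3].
  apply: integral_ae_eq => //=.
  + by apply/measurable_EFinP; exact: measurable_gauss.
  + move=> E E01 mE; rewrite -h3//=.
    by rewrite -gauss_probE.
Qed.

Import HBNNSimple.
(** Needed where integrability is what has to be proved, as for the moments below. Simple functions
    are bounded, hence covered by [integral_gauss_prob], and monotone convergence does the rest. *)
Lemma ge0_integral_gauss_prob v (f : R -> \bar R) : 0 < v ->
  measurable_fun setT f -> (forall y, 0 <= f y)%E ->
  (\int[gauss_prob v]_y f y = \int[mu]_y (f y * (gauss v y)%:E))%E.
Proof.
move=> v0 mf f0; pose g := nnsfun_approx measurableT mf.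
have glim y : (g n y)%:E @[n --> \oo] --> f y by apply: cvg_nnsfun_approx.
have gnd y : {homo (fun n => (g n y)%:E) : m n / (m <= n)%N >-> (m <= n)%E}.
  by move=> a b ab; rewrite lee_fin; exact/lefP/nd_nnsfun_approx.
have mg n : measurable_fun [set: R] (g n) by apply: measurable_funP.
transitivity (\int[gauss_prob v]_y limn (fun n => (g n y)%:E))%E.
  by apply: eq_integral => y _; apply/esym/cvg_lim => //; exact: glim.
rewrite monotone_convergence//; [|by move=> n; apply/measurable_EFinP; exact:
  mg|
  by move=> n y _; rewrite lee_fin].
transitivity (\int[mu]_y limn (fun n => (g n y)%:E * (gauss v y)%:E))%E; last
  first.
  apply: eq_integral => y _; apply/cvg_lim => //.
  by apply: cvgeZr => //; exact: glim.
rewrite monotone_convergence//; [|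
  by move=> n; apply: emeasurable_funM; apply/measurable_EFinP;
    [exact: mg|exact: measurable_gauss]|
  by move=> n y _; rewrite mule_ge0 ?lee_fin ?gauss_ge0|
  by move=> y _ a b ab; rewrite lee_pmul2r ?lte_fin ?gauss_gt0//; exact: gnd].
congr (limn _); apply/funext => n; apply: integral_gauss_prob => //.
have [M [_ gM]] := simple_bounded (g n).
apply: (@bounded_integrable _ _ _ (gauss_prob v) _ (M + 1)); first exact: mg.
by move=> y; apply: gM => //; rewrite ltrDl.
Qed.

End gauss_density.

Section gauss_identities.
Context {R : realType}.
Implicit Types (v x y m : R).
Local Notation mu := (@lebesgue_measure R).

Lemma gauss_le v y : 0 < v -> gauss v y <= gauss v 0.
Proof.
move=> v0; rewrite /gauss ler_pM2r; last first.
  by rewrite invr_gt0 sqrtr_gt0 !mulr_gt0 ?pi_gt0.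
rewrite ler_expR expr0n/= mul0r oppr0 oppr_le0.
by rewrite divr_ge0 ?sqr_ge0// mulr_ge0 ?ltW.
Qed.

(** Completing the square: an exponential tilt translates the Gaussian by [c * v]. *)
Lemma expR_gauss v c y : 0 < v ->
  expR (c * y) * gauss v y = expR (c ^+ 2 * v / 2) * gauss v (y - c * v).
Proof.
move=> v0; have v0' : v != 0 by rewrite gt_eqF.
rewrite /gauss !mulrA -!expRD; congr (expR _ / _).
by field.
Qed.

(** Completing the square in [y] factors the product into a function of [x] alone and a Gaussian
    density in [y], of mass one. The double minus sign puts that density in the form expected by
    [integral_gauss]. *)
Lemma gauss_convolution a b x y : 0 < a -> 0 < b ->
  gauss a (x + y) * gauss b y =
  gauss (a + b) x * gauss (a * b / (a + b)) (y - - (x * b / (a + b))).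
Proof.
move=> a0 b0; have ab0 : 0 < a + b by rewrite addr_gt0.
have a0' : a != 0 by rewrite gt_eqF.
have b0' : b != 0 by rewrite gt_eqF.
have ab0' : a + b != 0 by rewrite gt_eqF.
have p0 := @pi_gt0 R.
rewrite /gauss mulrACA -expRD -invfM -sqrtrM; last by rewrite !mulr_ge0 ?ltW.
rewrite [RHS]mulrACA -expRD -invfM -sqrtrM; last by rewrite !mulr_ge0 ?ltW.
congr (expR _ / Num.sqrt _); field => //.
by rewrite a0' b0' ab0'.
Qed.

Lemma integral_gauss_convolution a b x : 0 < a -> 0 < b ->
  (\int[gauss_prob b]_y (gauss a (x + y))%:E = (gauss (a + b) x)%:E)%E.
Proof.
move=> a0 b0; have ab0 : 0 < a + b by rewrite addr_gt0.
rewrite ge0_integral_gauss_prob; [|by []|apply/measurable_EFinP; apply: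
  (measurableT_comp (measurable_gauss a));
  exact: measurable_funD|
  by move=> y; rewrite lee_fin gauss_ge0].
under eq_integral do rewrite -EFinM gauss_convolution// EFinM.
rewrite ge0_integralZl; [|by []|apply/measurable_EFinP|
  by move=> y _; rewrite lee_fin gauss_ge0|by rewrite lee_fin gauss_ge0];
  last by apply: (measurableT_comp (measurable_gauss _)); exact:
    measurable_funB.
by rewrite integral_gauss ?mule1// divr_gt0 ?mulr_gt0.
Qed.

Lemma integral_expR_gauss v c : 0 < v ->
  (\int[gauss_prob v]_y (expR (c * y))%:E = (expR (c ^+ 2 * v / 2))%:E)%E.
Proof.
move=> v0; rewrite ge0_integral_gauss_prob; [|by []|apply/measurable_EFinP;
  apply: (measurableT_comp (@measurable_expR _));
  exact: measurable_funM|
  by move=> y; rewrite lee_fin expR_ge0].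
under eq_integral do rewrite -EFinM expR_gauss// EFinM.
rewrite ge0_integralZl; [|by []|apply/measurable_EFinP|
  by move=> y _; rewrite lee_fin gauss_ge0|by rewrite lee_fin expR_ge0];
  last by apply: (measurableT_comp (measurable_gauss _)); exact:
    measurable_funB.
by rewrite integral_gauss ?mule1.
Qed.

(** The factor changes the inverse variance from 1/v to 1/v + 2c. For negative [c] the second
    hypothesis says that this is still positive. *)
Lemma expR_sqr_gauss v c y : 0 < v -> 0 < 1 + 2 * c * v ->
  expR (- c * y ^+ 2) * gauss v y =
  (Num.sqrt (1 + 2 * c * v))^-1 * gauss (v / (1 + 2 * c * v)) y.
Proof.
move=> v0 c0; have p0 := @pi_gt0 R.
have v0' : v != 0 by rewrite gt_eqF.
have c0' : 1 + 2 * c * v != 0 by rewrite gt_eqF.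
rewrite /gauss mulrA -expRD [RHS]mulrCA -invfM -sqrtrM ?ltW//.
congr (expR _ / Num.sqrt _); field => //.
by rewrite v0' c0'.
Qed.

Lemma integral_expR_sqr_gauss v c : 0 < v -> 0 < 1 + 2 * c * v ->
  (\int[gauss_prob v]_y (expR (- c * y ^+ 2))%:E =
   ((Num.sqrt (1 + 2 * c * v))^-1)%:E)%E.
Proof.
move=> v0 c0; rewrite ge0_integral_gauss_prob; [|by []|apply/measurable_EFinP;
  apply: (measurableT_comp (@measurable_expR _));
  by apply: measurable_funM => //; exact: measurable_funX|
  by move=> y; rewrite lee_fin expR_ge0].
under eq_integral do rewrite -EFinM expR_sqr_gauss// EFinM.
rewrite ge0_integralZl; [|by []|apply/measurable_EFinP; exact: measurable_gauss|
  by move=> y _; rewrite lee_fin gauss_ge0|by rewrite lee_fin invr_ge0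
    sqrtr_ge0].
under eq_integral do rewrite -[X in gauss _ X]subr0.
by rewrite integral_gauss ?mule1// divr_gt0.
Qed.

(** Cube the inequality between a third of the absolute value and its exponential; 27 is the cube of
    3. *)
Lemma cube_le_expR (z : R) : `|z| ^+ 3 <= 27 * (expR z + expR (- z)).
Proof.
apply: (@le_trans _ _ (27 * expR `|z|)).
  have -> : expR `|z| = expR (`|z| / 3) ^+ 3.
    by rewrite -expRM_natl; congr expR; field.
  have -> : `|z| ^+ 3 = 27 * (`|z| / 3) ^+ 3 by field.
  rewrite ler_pM2l// lerXn2r ?nnegrE ?expR_ge0 ?divr_ge0//.
  by rewrite (le_trans _ (expR_ge1Dx _))// lerDr.
rewrite ler_pM2l//; case: (ger0P z) => _; first by rewrite lerDl expR_ge0.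
by rewrite lerDr expR_ge0.
Qed.

(** A bound for the third absolute moment of the standard normal law: 27 from [cube_le_expR], times
    two exponential moments, each equal to the exponential of 1/2. *)
Definition gauss_cube : R := 54 * expR (2^-1).

Lemma integral_cube_gauss v : 0 < v ->
  (\int[gauss_prob v]_y (`|y| ^+ 3)%:E <= (gauss_cube * (v * Num.sqrt v))%:E)%E.
Proof.
move=> v0; have s0 : 0 < Num.sqrt v by rewrite sqrtr_gt0.
have v3 : Num.sqrt v ^+ 3 = v * Num.sqrt v by rewrite exprSr sqr_sqrtr// ltW.
have mexp (c : R) : measurable_fun setT (fun y : R => expR (c * y)).
  by apply: (measurableT_comp (@measurable_expR _)); exact: measurable_funM.
(* Normalising by the standard deviation makes [c ^+ 2 * v] equal to 1, so that the exponential
   moments do not depend on [v]. *)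
set c := (Num.sqrt v)^-1.
have cv : c ^+ 2 * v = 1.
  by rewrite exprVn sqr_sqrtr ?ltW// mulVf ?gt_eqF.
pose k := 27 * Num.sqrt v ^+ 3.
have k0 : 0 <= k by rewrite mulr_ge0// exprn_ge0// ltW.
apply: (@le_trans _ _ (\int[gauss_prob v]_y
    (k%:E * ((expR (c * y))%:E + (expR (- c * y))%:E))))%E.
  apply: ge0_le_integral => //.
  - apply/measurable_EFinP/measurable_funX.
    exact: normr_measurable.
  - apply: emeasurable_funM => //; apply: emeasurable_funD;
      apply/measurable_EFinP; exact: mexp.
  - move=> y _; rewrite -EFinD -EFinM lee_fin.
    have -> : `|y| ^+ 3 = `|c * y| ^+ 3 * Num.sqrt v ^+ 3.
      rewrite -exprMn normrM gtr0_norm ?invr_gt0// mulrC mulrA divff ?mul1r//.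
      by rewrite gt_eqF.
    rewrite /k [leRHS]mulrAC ler_pM2r ?exprn_gt0// mulNr.
    exact: cube_le_expR.
rewrite ge0_integralZl; [|by []|
  by apply: emeasurable_funD; apply/measurable_EFinP; exact: mexp|
  by move=> y _; rewrite adde_ge0// lee_fin expR_ge0|by rewrite lee_fin].
rewrite ge0_integralD; [|by []|by move=> y _; rewrite lee_fin expR_ge0|
  by apply/measurable_EFinP; exact: mexp|
  by move=> y _; rewrite lee_fin expR_ge0|
  by apply/measurable_EFinP; exact: mexp].
rewrite !integral_expR_gauss// sqrrN cv -EFinD -EFinM lee_fin /k v3 mul1r.
by rewrite /gauss_cube le_eqVlt; apply/orP; left; apply/eqP; ring.
Qed.

Lemma integrable_cube_gauss v : 0 < v ->
  (gauss_prob v).-integrable setT (EFin \o (fun y : R => `|y| ^+ 3)).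
Proof.
move=> v0; apply/integrableP; split.
  by apply/measurable_EFinP/measurable_funX; exact: normr_measurable.
rewrite (le_lt_trans _ (ltry (gauss_cube * (v * Num.sqrt v))))//.
rewrite (le_trans _ (integral_cube_gauss v0))//.
rewrite le_eqVlt; apply/orP; left; apply/eqP; apply: eq_integral => y _ /=.
by rewrite ger0_norm// exprn_ge0.
Qed.

Lemma integrable_gauss_le_cube v (f : R -> R) (M : R) : 0 < v ->
  measurable_fun setT f -> (forall y, `|f y| <= M * (1 + `|y| ^+ 3)) ->
  (gauss_prob v).-integrable setT (EFin \o f).
Proof.
move=> v0 mf fM.
have := @le_integrable _ _ _ (gauss_prob v) setT measurableT (EFin \o f)
  (fun y : R => (M * (1 + `|y| ^+ 3))%:E); apply.
- exact/measurable_EFinP.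
- by move=> y _ /=; rewrite lee_fin (le_trans (fM y))// ler_norm.
have i1 := @bounded_integrable _ _ _ (gauss_prob v) (cst 1) 1.
have i2 : (gauss_prob v).-integrable setT
    (fun y : R => 1%:E + (`|y| ^+ 3)%:E)%E.
  apply: integrableD => //; last exact: integrable_cube_gauss.
  by apply: i1 => // x; rewrite normr1.
exact: (integrableZl measurableT M i2).
Qed.

End gauss_identities.

Section gauss_moments.
Context {R : realType}.
Implicit Types (v x y : R).
Local Notation mu := (@lebesgue_measure R).

Lemma integrable_gauss_id v : 0 < v ->
  (gauss_prob v).-integrable setT (EFin \o (fun y : R => y)).
Proof.
move=> v0; apply: (@integrable_gauss_le_cube _ _ _ 1) => // y.
rewrite mul1r; have := normr_ge0 y; set z := `|y| => z0.
have [z1|/ltW z1] := leP z 1; first by rewrite (le_trans z1)// lerDl exprn_ge0.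
by rewrite (@le_trans _ _ (z ^+ 3))// ?lerDr// -[leLHS]expr1 ler_weXn2l.
Qed.

Lemma integrable_gauss_sqr v : 0 < v ->
  (gauss_prob v).-integrable setT (EFin \o (fun y : R => y ^+ 2)).
Proof.
move=> v0; apply: (@integrable_gauss_le_cube _ _ _ 1) => // y.
rewrite mul1r normrX; have := normr_ge0 y; set z := `|y| => z0.
have [z1|/ltW z1] := leP z 1.
  by rewrite (@le_trans _ _ 1)// ?exprn_ile1// lerDl exprn_ge0.
by rewrite (@le_trans _ _ (z ^+ 3))// ?lerDr// ler_weXn2l.
Qed.

(** The integrand against Lebesgue measure is odd, so by invariance under reflection the integral is
    its own opposite. *)
Lemma Rintegral_gauss_id v : 0 < v -> \int[gauss_prob v]_y y = 0.
Proof.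
move=> v0; pose F y := (y * gauss v y)%:E.
have mF : measurable_fun setT F.
  by apply/measurable_EFinP/measurable_funM => //; exact: measurable_gauss.
have vi := integrable_gauss_id v0.
have E : (\int[gauss_prob v]_y y%:E = \int[mu]_y F y)%E.
  exact: (integral_gauss_prob v0 vi).
rewrite /Rintegral E.
have iF : mu.-integrable setT F.
  apply/integrableP; split => //.
  under eq_integral do rewrite /F abse_EFin normrM (ger0_norm (gauss_ge0 _ _))
    EFinM.
  rewrite -(@ge0_integral_gauss_prob _ v (fun y => `|y|%:E))//.
  - by move/integrableP : vi => [].
  - by apply/measurable_EFinP; exact: normr_measurable.
have FN y : F (- y) = (- F y)%E by rewrite /F gaussN mulNr EFinN.
have EN : (\int[mu]_y F y = - \int[mu]_y F y)%E.
  transitivity (\int[pushforward mu (-%R : R -> measurableTypeR R)]_y F y)%E.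
    by apply: eq_measure_integral => A mA _; exact/esym/lebesgue_measureN.
  rewrite integral_pushforward//.
    rewrite preimage_setT -integralN//.
      by apply: eq_integral => y _; exact: FN.
    exact: integrable_add_def iF.
  rewrite preimage_setT (_ : _ \o _ = (fun y => - F y)%E); last exact/funext.
  exact: integrableN.
have /fin_numP[] := integrable_fin_num measurableT iF.
case: (\int[mu]_y F y)%E EN => //= r [rE] _ _.
by lra.
Qed.

(** Only the coefficient of [x] must be exact. The generous 6, instead of the Taylor coefficient
    3/2, makes the difference of squares equal to [x ^+ 2] times a factor which is clearly positive
    on this range. *)
Lemma inv_sqrt_le (x : R) : `|x| <= 4^-1 ->
  (Num.sqrt (1 + 2 * x))^-1 <= 1 - x + 6 * x ^+ 2.
Proof.
rewrite ler_norml => /andP[x1 x2].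
have p0 : 0 < 1 + 2 * x by lra.
have q0 : 0 < 1 - x + 6 * x ^+ 2 by nra.
rewrite invf_ple ?posrE ?sqrtr_gt0//.
set q := 1 - _ + _ in q0 *.
have -> : q^-1 = Num.sqrt (q^-1 ^+ 2).
  by rewrite sqrtr_sqr ger0_norm// invr_ge0 ltW.
rewrite ler_wsqrtr//.
rewrite exprVn invf_ple ?posrE ?exprn_gt0// -[leLHS]mul1r ler_pdivrMr//.
rewrite -subr_ge0.
have -> : q ^+ 2 * (1 + 2 * x) - 1 =
  x ^+ 2 * (9 + 14 * x + 12 * x ^+ 2 * (1 + 6 * x)) by rewrite /q; ring.
by apply: mulr_ge0; [exact: sqr_ge0|nra].
Qed.

(* The Gaussian integral of [expR (- c * y ^+ 2)] is known exactly and dominates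
   that of [1 - c * y ^+ 2]; small [c] of either sign bound the variance from
   both sides. *)
Lemma Rintegral_gauss_sqr v : 0 < v -> \int[gauss_prob v]_y (y ^+ 2) = v.
Proof.
move=> v0; have v0' : v != 0 by rewrite gt_eqF.
have vi := integrable_gauss_sqr v0.
set m := Rintegral _ _ _.
have i1 : (gauss_prob v).-integrable setT (EFin \o cst (1 : R)).
  by apply: (@bounded_integrable _ _ _ _ _ 1) => // x; rewrite normr1.
have key c : 0 < 1 + 2 * c * v -> 1 - c * m <= (Num.sqrt (1 + 2 * c * v))^-1.
  move=> c0; have E := integral_expR_sqr_gauss v0 c0.
  have ei : (gauss_prob v).-integrable setT
      (EFin \o (fun y : R => expR (- c * y ^+ 2))).
    apply/integrableP; split.
      apply/measurable_EFinP; apply: (measurableT_comp (@measurable_expR _)).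
      by apply: measurable_funM => //; exact: measurable_funX.
    under eq_integral do rewrite /= ger0_norm ?expR_ge0//.
    by rewrite E ltry.
  have ci : (gauss_prob v).-integrable setT
      (EFin \o (fun y : R => c * y ^+ 2)).
    exact: (integrableZl measurableT c vi).
  have -> : (Num.sqrt (1 + 2 * c * v))^-1 =
      \int[gauss_prob v]_y (expR (- c * y ^+ 2)).
    by rewrite /Rintegral E.
  have -> : 1 - c * m = \int[gauss_prob v]_y (1 - c * y ^+ 2).
    rewrite RintegralB// RintegralZl// Rintegral_cst//.
    by rewrite [X in fine X]probability_setT mulr1.
  apply: le_Rintegral => //; first exact: (integrableB measurableT i1 ci).
  by move=> y _; rewrite (le_trans _ (expR_ge1Dx _))// mulNr.
(* With [c = x / v] the inequality concerns only the ratio [m / v], to be shown equal to 1. *)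
have key2 x : `|x| <= 4^-1 -> 1 - x * (m / v) <= 1 - x + 6 * x ^+ 2.
  move=> x4; rewrite (le_trans _ (inv_sqrt_le x4))//.
  have := key (x / v).
  rewrite (_ : 2 * (x / v) * v = 2 * x); last by field.
  rewrite (_ : x / v * m = x * (m / v)); last by field.
  apply.
  by move: x4; rewrite ler_norml; lra.
have m1 : m / v = 1.
  apply/eqP; rewrite -subr_eq0; apply/eqP/eqP; rewrite -normr_le0.
  apply/ler_addgt0Pr => e e0; rewrite add0r.
  (* After division by [x] the remainder is [6 * x], at most [e]; the signs + and - of [x] give the
     two sides of the bound. *)
  pose x := Num.min (4^-1) (e / 6).
  have x0 : 0 < x by rewrite lt_min invr_gt0 divr_gt0 ?ltr0n.
  have x4 : x <= 4^-1 by rewrite ge_min lexx.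
  have xe : x <= e / 6 by rewrite ge_min lexx orbT.
  have := key2 x; rewrite gtr0_norm// => /(_ x4) k1.
  have := key2 (- x); rewrite normrN gtr0_norm// => /(_ x4) k2.
  rewrite ler_norml; apply/andP; split.
    by rewrite -(ler_pM2l x0); nra.
  by rewrite -(ler_pM2l x0); nra.
by rewrite -[m](divfK v0') m1 mul1r.
Qed.

Lemma Rintegral_gauss_cube v : 0 < v ->
  \int[gauss_prob v]_y (`|y| ^+ 3) <= gauss_cube * (v * Num.sqrt v).
Proof.
move=> v0; rewrite -lee_fin fineK; first exact: integral_cube_gauss.
by apply: integrable_fin_num => //; exact: integrable_cube_gauss.
Qed.

End gauss_moments.

(** * Taylor expansion under Gaussian averages *)

Section taylor.
Context {R : realType}.
Implicit Types (g q : R -> R) (x y z M : R).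

Lemma is_derive_cont g g1 : (forall y, is_derive y 1 g (g1 y)) -> continuous g.
Proof.
move=> dg y; apply: differentiable_continuous; apply/derivable1_diffP.
by have [] := dg y.
Qed.

Lemma le_derive_bound q q1 B r z : (forall y, is_derive y 1 q (q1 y)) ->
  (forall y, `|y| <= r -> `|q1 y| <= B) -> q 0 = 0 -> `|z| <= r ->
  `|q z| <= B * `|z|.
Proof.
move=> dq q1B q0 zr; have cq := is_derive_cont dq.
have [->|/eqP z0] := eqVneq z 0; first by rewrite q0 !normr0 mulr0.
have [zpos|zneg|//] := ltgtP z 0.
- have [c /[!in_itv]/= /andP[zc c0]] := @MVT R q q1 z 0 zpos
    (fun y _ => dq y) (continuous_subspaceT cq).
  rewrite q0 !sub0r => E; rewrite -normrN E normrM normrN ler_wpM2r//.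
  by apply: q1B; rewrite (le_trans _ zr)// !ltr0_norm// lerN2 ltW.
- have [c /[!in_itv]/= /andP[c0 zc]] := @MVT R q q1 0 z zneg
    (fun y _ => dq y) (continuous_subspaceT cq).
  rewrite q0 !subr0 => ->; rewrite normrM ler_wpM2r//.
  by apply: q1B; rewrite (le_trans _ zr)// !gtr0_norm// ltW.
Qed.

(** A cubic remainder valid on the whole line, as Gaussian averages require, although derivatives
    are controlled only at [x] or within distance 1 of it. Beyond distance 1 the bound on [g] itself
    suffices, since all lower powers of the distance are below its cube. *)
Lemma taylor3 g g1 g2 g3 x M z :
  (forall y, is_derive y 1 g (g1 y)) -> (forall y, is_derive y 1 g1 (g2 y)) ->
  (forall y, is_derive y 1 g2 (g3 y)) ->
  (forall y, `|g y| <= M) -> `|g1 x| <= M -> `|g2 x| <= M ->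
  (forall y, `|y| <= 1 -> `|g3 (x + y)| <= M) ->
  `|g (x + z) - (g x + g1 x * z + g2 x / 2 * z ^+ 2)| <= 4 * M * `|z| ^+ 3.
Proof.
move=> d0 d1 d2 gM g1M g2M g3M.
have M0 : 0 <= M by rewrite (le_trans _ (gM 0)).
have shift (f f1 : R -> R) : (forall y, is_derive y 1 f (f1 y)) ->
    forall y : R, is_derive y 1 (fun y => f (x + y)) (f1 (x + y)).
  move=> df y; have := df (x + y) => dfy.
  have dxy : is_derive y 1 (fun y : R => x + y) 1.
    by rewrite -[X in is_derive _ _ _ X]add0r; apply: is_deriveD.
  have := @is_derive1_comp _ f (fun y : R => x + y) y _ _ dfy dxy.
  by rewrite mulr1.
have [z1|z1] := leP `|z| 1; last first.
  have zz2 : `|z| <= `|z| ^+ 3 by rewrite -[leLHS]expr1 ler_weXn2l// ltW.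
  have zz3 : `|z| ^+ 2 <= `|z| ^+ 3 by rewrite ler_weXn2l// ltW.
  have zz1 : 1 <= `|z| ^+ 3 by rewrite (le_trans _ zz2)// ltW.
  apply: (@le_trans _ _ (M + (M + M * `|z| + M * `|z| ^+ 2))).
    rewrite (le_trans (ler_normB _ _))// lerD//.
    rewrite (le_trans (ler_normD _ _))// lerD//.
      by rewrite (le_trans (ler_normD _ _))// lerD// normrM ler_wpM2r.
    rewrite normrM normrX ler_wpM2r ?exprn_ge0// normrM [`|2^-1|]ger0_norm//.
    by rewrite (le_trans _ g2M)// ler_piMr// invf_le1// ler1n.
  have -> : 4 * M * `|z| ^+ 3 = M * (4 * `|z| ^+ 3) by ring.
  have -> : M + (M + M * `|z| + M * `|z| ^+ 2) = M * (2 + `|z| + `|z| ^+ 2).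
    by ring.
  by rewrite ler_wpM2l//; lra.
(* The three remainders vanish at 0 and each is the derivative of the next one, so three mean value
   inequalities climb from [g3] to [q0]. The factor 1/6 lost on the way is harmless. *)
pose q2 y := g2 (x + y) - g2 x.
pose q1 y := g1 (x + y) - (g1 x + g2 x * y).
pose q0 y := g (x + y) - (g x + g1 x * y + g2 x / 2 * y ^+ 2).
have dq2 y : is_derive y 1 q2 (g3 (x + y)).
  by have := shift _ _ d2 y => ?; apply: is_derive_eq; rewrite subr0.
have dq1 y : is_derive y 1 q1 (q2 y).
  have := shift _ _ d1 y => ?; apply: is_derive_eq.
  by rewrite /q2 /GRing.scale/=; ring.
have dq0 y : is_derive y 1 q0 (q1 y).
  have := shift _ _ d0 y => ?; apply: is_derive_eq.
  by rewrite /q1 /GRing.scale/=; field.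
rewrite (_ : 4 * M * `|z| ^+ 3 = 3 * M * `|z| ^+3 + M * `|z| * `|z| * `|z|);
  last by ring.
rewrite -[leLHS]add0r lerD// ?mulr_ge0 ?exprn_ge0//.
apply: (@le_derive_bound q0 q1 _ `|z|) => //; last first.
  by rewrite /q0 addr0; ring.
move=> y yz.
apply: (@le_trans _ _ (M * `|z| * `|y|)); last by rewrite ler_wpM2l// mulr_ge0.
apply: (@le_derive_bound q1 q2 _ `|z|) => //; last first.
  by rewrite /q1 addr0; ring.
move=> {yz}y yz.
apply: (@le_trans _ _ (M * `|y|)); last by rewrite ler_wpM2l.
apply: (@le_derive_bound q2 (fun y => g3 (x + y)) _ `|z|) => //.
  by move=> w wz; apply: g3M; rewrite (le_trans wz).
by rewrite /q2 addr0 subrr.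
Qed.
End taylor.

Section gauss_taylor.
Context {R : realType}.
Implicit Types (g : R -> R) (c v x y z M : R).

Lemma cubeD_le y z : `|y + z| ^+ 3 <= 4 * (`|y| ^+ 3 + `|z| ^+ 3).
Proof.
have h := ler_normD y z; have y0 := normr_ge0 y; have z0 := normr_ge0 z.
rewrite (@le_trans _ _ ((`|y| + `|z|) ^+ 3))//.
  by rewrite lerXn2r// nnegrE// addr_ge0.
move: y0 z0; set a := `|y|; set b := `|z| => a0 b0.
rewrite -subr_ge0.
have -> : 4 * (a ^+ 3 + b ^+ 3) - (a + b) ^+ 3 = 3 * (a + b) * (a - b) ^+ 2 by
  ring.
by rewrite mulr_ge0 ?sqr_ge0// mulr_ge0// addr_ge0.
Qed.

(** Terms of second order in the time step fit into the error of order 3/2. *)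
Lemma le_mul_sqrt v : 0 < v -> v <= 1 -> v ^+ 2 <= v * Num.sqrt v.
Proof.
move=> v0 v1; rewrite expr2 ler_pM2l//.
rewrite -[leLHS]gtr0_norm// -sqrtr_sqr ler_wsqrtr//.
by rewrite expr2 ler_piMr// ltW.
Qed.

(** Here [c] is the displacement due to the drift, of order [v]. Averaging removes the term linear
    in [y] and turns its square into [v]. The error collects the term in [c ^+ 2], which gives
    [M ^+ 3], and the cubic remainder, where 16 is the 4 of [taylor3] times the 4 of [cubeD_le]. *)
Lemma gauss_taylor g g1 g2 g3 x M c v :
  (forall y, is_derive y 1 g (g1 y)) -> (forall y, is_derive y 1 g1 (g2 y)) ->
  (forall y, is_derive y 1 g2 (g3 y)) ->
  (forall y, `|g y| <= M) -> `|g1 x| <= M -> `|g2 x| <= M ->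
  (forall y, `|y| <= 1 -> `|g3 (x + y)| <= M) ->
  0 < v -> v <= 1 -> `|c| <= M * v ->
  `|\int[gauss_prob v]_y g (x + c + y) - (g x + g1 x * c + g2 x / 2 * v)|
  <= (M ^+ 3 + 16 * M * (M ^+ 3 + gauss_cube)) * (v * Num.sqrt v).
Proof.
move=> d0 d1 d2 gM g1M g2M g3M v0 v1 cM.
have M0 : 0 <= M by rewrite (le_trans _ (gM 0)).
have K0 : 0 <= @gauss_cube R by rewrite /gauss_cube mulr_ge0// expR_ge0.
set s := v * Num.sqrt v; have v2s : v ^+ 2 <= s by exact: le_mul_sqrt.
have v3s : v ^+ 3 <= s.
  by rewrite (le_trans _ v2s)// ler_wiXn2l// ltW.
have c2 : c ^+ 2 <= M ^+ 2 * s.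
  rewrite -[c ^+ 2]ger0_norm ?sqr_ge0// normrX.
  rewrite (@le_trans _ _ ((M * v) ^+ 2))//.
    by rewrite lerXn2r// nnegrE// mulr_ge0// ltW.
  by rewrite exprMn ler_wpM2l// exprn_ge0.
have c3 : `|c| ^+ 3 <= M ^+ 3 * s.
  rewrite (@le_trans _ _ ((M * v) ^+ 3))//.
    by rewrite lerXn2r// nnegrE// mulr_ge0// ltW.
  by rewrite exprMn ler_wpM2l// exprn_ge0.
pose k := g2 x / 2.
(* The Taylor polynomial at [x], evaluated at [c + y] and sorted by powers of [y]. *)
pose p0 := g x + g1 x * c + k * c ^+ 2.
pose p1 := g1 x + 2 * k * c.
pose p y := p0 + (p1 * y + k * y ^+ 2).
have i1 := @integrable_gauss_id _ _ v0.
have i2 := @integrable_gauss_sqr _ _ v0.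
have i3 := @integrable_cube_gauss _ _ v0.
have ic (r : R) : (gauss_prob v).-integrable setT (EFin \o cst r).
  by apply: (@bounded_integrable _ _ _ _ _ `|r|).
have ip1 : (gauss_prob v).-integrable setT (EFin \o (fun y : R => p1 * y)).
  exact: (integrableZl measurableT p1 i1).
have ip2 : (gauss_prob v).-integrable setT (EFin \o (fun y : R => k * y ^+ 2)).
  exact: (integrableZl measurableT k i2).
have ip12 : (gauss_prob v).-integrable setT
    (EFin \o (fun y : R => p1 * y + k * y ^+ 2)).
  exact: (integrableD measurableT ip1 ip2).
have ip : (gauss_prob v).-integrable setT (EFin \o p).
  exact: (integrableD measurableT (ic p0) ip12).
have ig : (gauss_prob v).-integrable setT (EFin \o (fun y : R => g (x + c +
  y))).
  apply: (@bounded_integrable _ _ _ _ _ M) => //.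
  apply: (measurableT_comp (continuous_measurable_fun (is_derive_cont d0))).
  exact: measurable_funD.
have Ep : \int[gauss_prob v]_y p y = p0 + k * v.
  rewrite RintegralD//; last exact: (ic p0).
  rewrite (RintegralD measurableT ip1 ip2).
  have -> : \int[gauss_prob v]_y (p1 * y) = p1 * \int[gauss_prob v]_y y.
    exact: (RintegralZl p1 measurableT i1).
  have -> : \int[gauss_prob v]_y (k * y ^+ 2) = k * \int[gauss_prob v]_y (y ^+
    2).
    exact: (RintegralZl k measurableT i2).
  rewrite Rintegral_gauss_id// Rintegral_gauss_sqr// mulr0 add0r.
  by rewrite Rintegral_cst// [X in fine X]probability_setT mulr1.
have -> : \int[gauss_prob v]_y g (x + c + y) - (g x + g1 x * c + g2 x / 2 * v) =
    k * c ^+ 2 + \int[gauss_prob v]_y (g (x + c + y) - p y).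
  by rewrite RintegralB// Ep /p0 /k; ring.
rewrite mulrDl (le_trans (ler_normD _ _))// lerD//.
  rewrite normrM [`|c ^+ 2|]ger0_norm ?sqr_ge0// (@le_trans _ _ (M * (M ^+ 2 *
    s)))//.
    rewrite ler_pM// ?sqr_ge0//.
    rewrite /k normrM [`|2^-1|]ger0_norm// (le_trans _ g2M)//.
    by rewrite ler_piMr// invf_le1// ler1n.
  by rewrite mulrA -exprS.
have igp : (gauss_prob v).-integrable setT
    (EFin \o (fun y : R => g (x + c + y) - p y)).
  exact: (integrableB measurableT ig ip).
rewrite (le_trans (le_normr_Rintegral _ igp))//.
pose r y : R := 16 * M * (`|c| ^+ 3 + `|y| ^+ 3).
have icy : (gauss_prob v).-integrable setT
    (EFin \o (fun y : R => `|c| ^+ 3 + `|y| ^+ 3)).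
  exact: (integrableD measurableT (ic _) i3).
have ir : (gauss_prob v).-integrable setT (EFin \o r).
  exact: (integrableZl measurableT (16 * M) icy).
apply: (@le_trans _ _ (\int[gauss_prob v]_y r y)).
  apply: le_Rintegral => //.
    exact: (integrable_norm igp).
  move=> y _.
  have := taylor3 (c + y) d0 d1 d2 gM g1M g2M g3M; rewrite addrA.
  rewrite (_ : p y = g x + g1 x * (c + y) + g2 x / 2 * (c + y) ^+ 2); last
    first.
    by rewrite /p /p0 /p1 /k; field.
  move/le_trans; apply.
  rewrite /r (_ : 16 * M * _ = 4 * M * (4 * (`|c| ^+ 3 + `|y| ^+ 3))); last by
    ring.
  by rewrite ler_wpM2l ?mulr_ge0//; exact: cubeD_le.
rewrite RintegralZl// RintegralD//; last exact: ic.
rewrite Rintegral_cst// [X in fine X]probability_setT mulr1.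
rewrite -[leRHS]mulrA ler_wpM2l ?mulr_ge0// mulrDl lerD//.
exact: Rintegral_gauss_cube.
Qed.

End gauss_taylor.

(** * Space-time functions with bounds on their space derivatives *)

Section families.
Context {R : realType}.
Variable t : R.
Implicit Types (w : R -> R -> R) (s r x y L M : R).

(** Uniform in time but local in space, because the drift and [1 / h] are unbounded on the line. *)
Definition locally_bounded w :=
  forall L, exists M, forall s x, 0 <= s <= t -> `|x| <= L -> `|w s x| <= M.

Definition globally_bounded w :=
  exists M, forall s x, 0 <= s <= t -> `|w s x| <= M.

Lemma globally_boundedW w : globally_bounded w -> locally_bounded w.
Proof. by move=> [M wM] L; exists M => s x st _; exact: wM. Qed.

Lemma locally_boundedC (k : R) : locally_bounded (fun _ _ => k).
Proof. by move=> L; exists `|k|. Qed.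

Lemma locally_boundedD w w' : locally_bounded w -> locally_bounded w' ->
  locally_bounded (fun s x => w s x + w' s x).
Proof.
move=> bw bw' L; have [M wM] := bw L; have [M' wM'] := bw' L.
exists (M + M') => s x st xL; rewrite (le_trans (ler_normD _ _))// lerD//.
  exact: wM.
exact: wM'.
Qed.

Lemma locally_boundedN w : locally_bounded w ->
  locally_bounded (fun s x => - w s x).
Proof.
by move=> bw L; have [M wM] := bw L; exists M => s x st xL; rewrite normrN wM.
Qed.

Lemma locally_boundedM w w' : locally_bounded w -> locally_bounded w' ->
  locally_bounded (fun s x => w s x * w' s x).
Proof.
move=> bw bw' L; have [M wM] := bw L; have [M' wM'] := bw' L.
by exists (M * M') => s x st xL; rewrite normrM ler_pM// ?wM ?wM'.
Qed.

End families.

Ltac locally_bounded := repeat first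
  [assumption | exact: locally_boundedC | apply: locally_boundedD
  | apply: locally_boundedN | apply: locally_boundedM].

Section smooth_families.
Context {R : realType}.
Variable t : R.
Implicit Types (w : R -> R -> R) (s r x y L M : R).

(** The assumptions of [taylor3], uniformly in time: the function is bounded everywhere, its three
    space derivatives only on compact sets. *)
Record smooth_family w w1 w2 w3 : Prop := {
  smooth_bounded : globally_bounded t w ;
  smooth_bounded1 : locally_bounded t w1 ;
  smooth_bounded2 : locally_bounded t w2 ;
  smooth_bounded3 : locally_bounded t w3 ;
  smooth_derive0 : forall s x, 0 <= s <= t -> is_derive x 1 (w s) (w1 s x) ;
  smooth_derive1 : forall s x, 0 <= s <= t -> is_derive x 1 (w1 s) (w2 s x) ;
  smooth_derive2 : forall s x, 0 <= s <= t -> is_derive x 1 (w2 s) (w3 s x) }.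

Lemma smooth_family_taylor w w1 w2 w3 L M : smooth_family w w1 w2 w3 ->
  exists C, forall r x c v, 0 <= r <= t -> `|x| <= L -> 0 < v -> v <= 1 ->
    `|c| <= M * v ->
    `|\int[gauss_prob v]_y w r (x + c + y)
      - (w r x + w1 r x * c + w2 r x / 2 * v)| <= C * (v * Num.sqrt v).
Proof.
move=> [[M0 b0] b1 b2 b3 d0 d1 d2].
(* The third derivative is evaluated up to distance 1 from [x], hence [L + 1]. *)
have [M1 {}b1] := b1 L; have [M2 {}b2] := b2 L; have [M3 {}b3] := b3 (L + 1).
pose K := Num.max M (Num.max M0 (Num.max M1 (Num.max M2 M3))).
exists (K ^+ 3 + 16 * K * (K ^+ 3 + gauss_cube)) => r x c v rt xL v0 v1 cM.
have [KM K0 K1 K2 K3] : [/\ M <= K, M0 <= K, M1 <= K, M2 <= K & M3 <= K].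
  by split; rewrite !le_max lexx ?orbT.
apply: (@gauss_taylor _ (w r) (w1 r) (w2 r) (w3 r)) => //.
- by move=> y; exact: d0.
- by move=> y; exact: d1.
- by move=> y; exact: d2.
- by move=> y; rewrite (le_trans (b0 _ _ rt)).
- by rewrite (le_trans (b1 _ _ rt xL)).
- by rewrite (le_trans (b2 _ _ rt xL)).
- move=> y y1; rewrite (le_trans _ K3)// b3//.
  by rewrite (le_trans (ler_normD _ _))// lerD.
- by rewrite (le_trans cM)// ler_wpM2r// ltW.
Qed.

Lemma is_derive_div (a b : R -> R) (a1 b1 x : R) :
  is_derive x 1 a a1 -> is_derive x 1 b b1 -> b x != 0 ->
  is_derive x 1 (fun y => a y / b y) ((a1 - a x / b x * b1) / b x).
Proof.
move=> da db b0; have dbV := is_deriveV b0 db.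
by apply: is_derive_eq; rewrite /GRing.scale/=; field.
Qed.

(** The formulas come from differentiating [u * h = v] by the Leibniz rule and solving for the
    highest derivative of [u]. Thus each one is a sum of products of locally bounded functions, and
    [h] is inverted only to the first power. *)
Lemma smooth_family_div v v1 v2 v3 h h1 h2 h3 :
  smooth_family v v1 v2 v3 -> smooth_family h h1 h2 h3 ->
  (forall s x, 0 < h s x) -> locally_bounded t (fun s x => (h s x)^-1) ->
  globally_bounded t (fun s x => v s x / h s x) ->
  let u s x := v s x / h s x in
  let u1 s x := (v1 s x - u s x * h1 s x) / h s x in
  let u2 s x := (v2 s x - 2 * u1 s x * h1 s x - u s x * h2 s x) / h s x in
  let u3 s x := (v3 s x - 3 * u2 s x * h1 s x - 3 * u1 s x * h2 s x
                 - u s x * h3 s x) / h s x in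
  smooth_family u u1 u2 u3.
Proof.
move=> sv sh h0 hV ub u u1 u2 u3.
have [vb vb1 vb2 vb3 vd0 vd1 vd2] := sv.
have [hb hb1 hb2 hb3 hd0 hd1 hd2] := sh.
have bu : locally_bounded t u by exact: globally_boundedW.
have bu1 : locally_bounded t u1 by locally_bounded.
have bu2 : locally_bounded t u2 by locally_bounded.
have bu3 : locally_bounded t u3 by locally_bounded.
have du0 s x : 0 <= s <= t -> is_derive x 1 (u s) (u1 s x).
  move=> st; apply: (is_derive_div (vd0 s x st) (hd0 s x st)).
  by rewrite gt_eqF.
have du1 s x : 0 <= s <= t -> is_derive x 1 (u1 s) (u2 s x).
  move=> st; have hn : h s x != 0 by rewrite gt_eqF.
  have := du0 s x st => ?; have := vd1 s x st => ?.
  have := hd0 s x st => hd; have := hd1 s x st => ?.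
  pose n y := v1 s y - u s y * h1 s y.
  have dn : is_derive x 1 n (v2 s x - (u1 s x * h1 s x + u s x * h2 s x)).
    by apply: is_derive_eq; rewrite /GRing.scale/=; ring.
  have := is_derive_div dn hd hn; congr (is_derive x 1 _ _).
  by rewrite -/(u1 s x) /u2; congr (_ / _); rewrite /n -/(u1 s x); ring.
split=> // s x st.
have hn : h s x != 0 by rewrite gt_eqF.
have := du0 s x st => ?; have := du1 s x st => ?; have := vd2 s x st => ?.
have := hd0 s x st => hd; have := hd1 s x st => ?; have := hd2 s x st => ?.
pose n y := v2 s y - 2 * u1 s y * h1 s y - u s y * h2 s y.
have dn : is_derive x 1 n (v3 s x - (2 * u2 s x * h1 s x + 2 * u1 s x * h2 s x)
    - (u1 s x * h2 s x + u s x * h3 s x)).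
  by apply: is_derive_eq; rewrite /GRing.scale/=; ring.
have := is_derive_div dn hd hn; congr (is_derive x 1 _ _).
by rewrite -/(u2 s x) /u3; congr (_ / _); rewrite /n -/(u2 s x); ring.
Qed.

Lemma smooth_family_lipschitz w w1 w2 w3 (L : R) : smooth_family w w1 w2 w3 ->
  exists C, forall s x y, 0 <= s <= t -> `|x| <= L -> `|y| <= L ->
    `|w s x - w s y| <= C * `|x - y|.
Proof.
move=> [_ b1 _ _ d0 _ _]; have [C b] := b1 L; exists C => s.
suff H x y : 0 <= s <= t -> `|x| <= L -> `|y| <= L -> x <= y ->
    `|w s x - w s y| <= C * `|x - y|.
  move=> x y st xL yL; have [xy|/ltW yx] := leP x y; first exact: H.
  by rewrite distrC [`|x - y|]distrC; exact: H.
move=> st xL yL xy.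
have cw := is_derive_cont (fun z => d0 s z st).
have [z zxy E] := @MVT_segment R (w s) (w1 s) x y xy
  (fun z _ => d0 s z st) (continuous_subspaceT cw).
rewrite distrC E normrM [`|x - y|]distrC ler_wpM2r// b//.
move: zxy xL yL; rewrite in_itv/= !ler_norml => /andP[z1 z2].
by move=> /andP[x1 _] /andP[_ y2]; rewrite (le_trans x1)//= (le_trans z2).
Qed.

End smooth_families.

(** * The local error of one Euler step *)

Section one_step.
Context {R : realType}.
Variable t : R.
Implicit Types (w : R -> R -> R) (s r x y L M : R).

(** Space-time harmonicity for Brownian motion, in integrated form: it stands for the backward heat
    equation. *)
Definition heat_semigroup w := forall s r x, 0 <= s -> s < r -> r <= t ->
  w s x = \int[gauss_prob (r - s)]_y w r (x + y).

(** The suffix [s] marks values at the start [s] of the step, the other values are at its end [r];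
    [D] is the length of the step, [dl] its power 3/2, and [E] the average of u. After
    multiplication by [Hs], the terms linear in [D] are U H2/2 + H U2/2 + U1 H1 - V2/2, which vanish
    by the Leibniz formula for [V2]. The rest is at most [6 * K ^+ 3 + K ^+ 2] times [dl]. *)
Lemma one_step_algebra (K dl D U U1 U2 H H1 H2 H3 V2 Hs H1s Vs E e1 e2 e3 e4 :
  R) :
  1 <= K -> 0 <= D -> D <= 1 -> D ^+ 2 <= dl ->
  [/\ `|U| <= K, `|U1| <= K & `|U2| <= K] ->
  [/\ `|H2| <= K, `|H3| <= K, `|Hs| <= K & `|Hs^-1| <= K] ->
  [/\ `|e1| <= K * dl, `|e2| <= K * dl, `|e3| <= K * dl & `|e4| <= K * dl] ->
  Hs != 0 -> V2 = U2 * H + 2 * U1 * H1 + U * H2 ->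
  Hs = H + H2 / 2 * D + e1 -> Vs = U * H + V2 / 2 * D + e2 ->
  H1s = H1 + H3 / 2 * D + e3 ->
  E = U + U1 * (H1s / Hs * D) + U2 / 2 * D + e4 ->
  `|E - Vs / Hs| <= 7 * K ^+ 3 * dl.
Proof.
move=> K1 D0 D1 D2 [U0 U10 U20] [H20 H30 Hs0 HsV0] [e10 e20 e30 e40] Hs_neq0.
move=> V2E HsE VsE H1sE EE.
have K0 : 0 <= K by rewrite (le_trans _ K1).
have dl0 : 0 <= dl by rewrite (le_trans _ D2)// sqr_ge0.
have -> : E - Vs / Hs = Hs^-1 * (e1 * (U + U2 / 2 * D) + Hs * e4 + U1 * (e3 * D)
    + (H2 * U2 / 4 + U1 * H3 / 2) * D ^+ 2 - e2).
  have -> : E - Vs / Hs =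
      Hs^-1 * (Hs * (U + U2 / 2 * D + e4) + U1 * H1s * D - Vs).
    by rewrite EE; field.
  congr (_ * _); rewrite VsE V2E H1sE.
  rewrite [X in X * (U + _ + _)]HsE mulrDr [in RHS]HsE.
  by field.
have half (a b : R) : `|a| <= b -> `|a / 2| <= b.
  move=> ab; rewrite normrM [`|2^-1|]ger0_norm// (le_trans _ ab)//.
  by rewrite ler_piMr// invf_le1// ler1n.
have mulD (a b : R) : `|a| <= b -> `|a * D| <= b.
  move=> ab; rewrite normrM [`|D|]ger0_norm// (le_trans _ ab)//.
  by rewrite ler_piMr.
have mulK (a b c d : R) : `|a| <= c -> `|b| <= d -> `|a * b| <= c * d.
  by move=> ac bd; rewrite normrM ler_pM.
have addK (a b c d : R) : `|a| <= c -> `|b| <= d -> `|a + b| <= c + d.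
  by move=> ac bd; rewrite (le_trans (ler_normD _ _))// lerD.
apply: (@le_trans _ _ (K * (K * dl * (K + K) + K * (K * dl) + K * (K * dl)
    + (K * K + K * K) * dl + K * dl))).
  apply: (mulK) => //; apply: (addK); last by rewrite normrN.
  apply: (addK); last first.
    apply: (mulK); last by rewrite ger0_norm// sqr_ge0.
    apply: (addK); last by apply: (half); exact: mulK.
    rewrite (_ : H2 * U2 / 4 = H2 * U2 / 2 / 2); last by field.
    by do 2 apply: (half); exact: mulK.
  apply: (addK); last by apply: (mulK) => //; exact: mulD.
  apply: (addK); last exact: mulK.
  by apply: (mulK) => //; apply: (addK) => //; apply: (mulD); exact: half.
have -> : K * (K * dl * (K + K) + K * (K * dl) + K * (K * dl)
    + (K * K + K * K) * dl + K * dl) = (6 * K ^+ 3 + K ^+ 2) * dl by ring.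
rewrite ler_wpM2r//.
have -> : 7 * K ^+ 3 = 6 * K ^+ 3 + K ^+ 3 by ring.
by rewrite lerD2l ler_weXn2l.
Qed.

(* No derivative in time occurs: the semigroup property at time [r] expresses
   [v s], [h s] and [h1 s] through Gaussian averages of their values at [r],
   which have Taylor expansions in space. *)
Lemma one_step v v1 v2 v3 h h1 h2 h3 h4 L :
  smooth_family t v v1 v2 v3 -> smooth_family t h h1 h2 h3 ->
  smooth_family t h1 h2 h3 h4 ->
  (forall s x, 0 < h s x) -> locally_bounded t (fun s x => (h s x)^-1) ->
  globally_bounded t (fun s x => v s x / h s x) ->
  heat_semigroup v -> heat_semigroup h -> heat_semigroup h1 ->
  exists C, forall s r x, 0 <= s -> s < r -> r <= t -> r - s <= 1 -> `|x| <= L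
    ->
    `|\int[gauss_prob (r - s)]_y
        (v r (x + h1 s x / h s x * (r - s) + y)
         / h r (x + h1 s x / h s x * (r - s) + y))
      - v s x / h s x| <= C * ((r - s) * Num.sqrt (r - s)).
Proof.
move=> sv sh sh1 h0 hV ub Sv Sh Sh1.
have su := smooth_family_div sv sh h0 hV ub.
have bf : locally_bounded t (fun s x => h1 s x / h s x).
  by apply: locally_boundedM => //; exact: (smooth_bounded1 sh).
have [Mf {}bf] := bf L; have [Mi {}hV] := hV L.
(* The bound 0 on the displacement fits [h], [v] and [h1], which are averaged along Brownian motion
   without drift. Only u is displaced, by the drift bounded by [Mf]. *)
have [Ch eh] := smooth_family_taylor L 0 sh.
have [Cv ev] := smooth_family_taylor L 0 sv.
have [Ch1 eh1] := smooth_family_taylor L 0 sh1.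
have [Cu eu] := smooth_family_taylor L Mf su.
have [Mh bh] := smooth_bounded sh.
have [Mh2 bh2] := smooth_bounded2 sh L.
have [Mh3 bh3] := smooth_bounded3 sh L.
have [Mu bu] := smooth_bounded su.
have [Mu1 bu1] := smooth_bounded1 su L.
have [Mu2 bu2] := smooth_bounded2 su L.
pose K := Num.max 1 (Num.max Mf (Num.max Mi (Num.max Ch (Num.max Cv (Num.max Ch1
  (Num.max Cu (Num.max Mh (Num.max Mh2 (Num.max Mh3 (Num.max Mu
  (Num.max Mu1 Mu2))))))))))).
have [[K1 Kf Ki Kh Kv] [Kh1 Ku KMh K2 K3] [KMu Ku1 Ku2]] :
    [/\ [/\ 1 <= K, Mf <= K, Mi <= K, Ch <= K & Cv <= K],
        [/\ Ch1 <= K, Cu <= K, Mh <= K, Mh2 <= K & Mh3 <= K]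
      & [/\ Mu <= K, Mu1 <= K & Mu2 <= K]].
  by split; split; rewrite !le_max lexx ?orbT.
exists (7 * K ^+ 3) => s r x s0 sr rt rs1 xL.
have rt' : 0 <= r <= t by rewrite rt (le_trans s0 (ltW sr)).
have st' : 0 <= s <= t by rewrite s0 (le_trans (ltW sr) rt).
have D0 : 0 < r - s by rewrite subr_gt0.
have dl0 : 0 <= (r - s) * Num.sqrt (r - s) by rewrite mulr_ge0 ?sqrtr_ge0// ltW.
have hr : h r x != 0 by rewrite gt_eqF.
(* For harmonic functions, the expansion at time [r] without displacement is an expansion of the
   value at time [s]. *)
have E (w w1 w2 : R -> R -> R) C : heat_semigroup w ->
    (forall r x c v, 0 <= r <= t -> `|x| <= L -> 0 < v -> v <= 1 ->
    `|c| <= 0 * v ->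
    `|\int[gauss_prob v]_y w r (x + c + y)
      - (w r x + w1 r x * c + w2 r x / 2 * v)| <= C * (v * Num.sqrt v)) ->
    `|w s x - (w r x + w2 r x / 2 * (r - s))| <= C * ((r - s) * Num.sqrt (r -
      s)).
  move=> Sw /(_ r x 0 (r - s) rt' xL D0 rs1).
  by rewrite normr0 mul0r lexx !addr0 mulr0 addr0 (Sw s r)//; apply.
have {}eh := E _ _ _ _ Sh eh.
have {}ev := E _ _ _ _ Sv ev.
have {}eh1 := E _ _ _ _ Sh1 eh1.
have cM : `|h1 s x / h s x * (r - s)| <= Mf * (r - s).
  by rewrite normrM [`|r - s|]gtr0_norm// ler_wpM2r ?bf// ltW.
have {}eu := eu r x _ (r - s) rt' xL D0 rs1 cM.
have lK (a b : R) : a <= b * ((r - s) * Num.sqrt (r - s)) -> b <= K ->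
    a <= K * ((r - s) * Num.sqrt (r - s)).
  by move=> ab bK; rewrite (le_trans ab)// ler_wpM2r.
have hs : h s x != 0 by rewrite gt_eqF.
apply: (@one_step_algebra K _ (r - s) _ _ _ (h r x) (h1 r x) (h2 r x) (h3 r x)
  (v2 r x) (h s x) (h1 s x) (v s x) _ _ _ _ _ K1 (ltW D0) rs1
  (le_mul_sqrt D0 rs1)
  (And3 (le_trans (bu _ _ rt') KMu) (le_trans (bu1 _ _ rt' xL) Ku1)
        (le_trans (bu2 _ _ rt' xL) Ku2))
  (And4 (le_trans (bh2 _ _ rt' xL) K2) (le_trans (bh3 _ _ rt' xL) K3)
        (le_trans (bh _ _ st') KMh) (le_trans (hV _ _ st' xL) Ki))
  (And4 (lK _ _ eh Kh) (lK _ _ ev Kv) (lK _ _ eh1 Kh1) (lK _ _ eu Ku))) => //.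
- by field; rewrite hr.
- by ring.
- by field; rewrite hr.
- by ring.
- by rewrite [RHS]addrC; apply/eqP; rewrite -subr_eq.
Qed.

End one_step.

(** * Independence and filtrations *)

Section independence.
Context {R : realType} d (Omega : measurableType d) (P : probability Omega R).
Context d1 (T1 : measurableType d1) d2 (T2 : measurableType d2).

Lemma fubini_F_EFin (N : probability T2 R) (g : T1 * T2 -> R) (M : R) :
  measurable_fun setT g -> (forall p, `|g p| <= M) ->
  fubini_F N (EFin \o g) = EFin \o (fun x => \int[N]_y g (x, y)).
Proof.
move=> mg gM; apply/funext => x; rewrite /fubini_F/= fineK//.
apply: (integrable_fin_num measurableT).
apply: (@bounded_integrable _ _ _ N (fun y => g (x, y)) M) => //.
exact: measurable_fun_pair2.
Qed.

(** The auxiliary [Q] supplies a product measure for which [g] is integrable, as the measurability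
    part of Fubini's theorem asks. *)
Lemma measurable_Rintegral_pair (Q : probability T1 R) (N : probability T2 R)
  (g : T1 * T2 -> R) (M : R) :
  measurable_fun setT g -> (forall p, `|g p| <= M) ->
  measurable_fun setT (fun x => \int[N]_y g (x, y)).
Proof.
move=> mg gM; apply/measurable_EFinP.
have ig : (Q \x N)%E.-integrable setT (EFin \o g) by exact: bounded_integrable.
have := measurable_fubini_F ig; rewrite (fubini_F_EFin _ mg gM).
exact.
Qed.

(** Independence on rectangles makes the joint law the product measure, by uniqueness of the latter;
    Fubini's theorem then integrates the second variable first. *)
Lemma indep_expectation (Z : Omega -> T1) (D : Omega -> T2)
    (N : probability T2 R) (g : T1 * T2 -> R) (M : R) :
  measurable_fun setT Z -> measurable_fun setT D ->
  (forall A B, measurable A -> measurable B ->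
    P (Z @^-1` A `&` D @^-1` B) = (P (Z @^-1` A) * N B)%E) ->
  measurable_fun setT g -> (forall p, `|g p| <= M) ->
  \int[P]_w g (Z w, D w) = \int[P]_w \int[N]_y g (Z w, y).
Proof.
move=> mZ mD ZD mg gM.
have mZD : measurable_fun setT (fun w => (Z w, D w)).
  exact: measurable_fun_pair.
pose Z' : {mfun Omega >-> T1} := mfun_Sub (mem_set mZ).
pose Q' : {mfun Omega >-> (T1 * T2)%type} := mfun_Sub (mem_set mZD).
have mgE : measurable_fun setT (EFin \o g) by exact/measurable_EFinP.
have QE A : measurable A -> (distribution P Z' \x N)%E A = distribution P Q' A.
  apply: product_measure_unique => A1 A2 mA1 mA2.
  rewrite /= /distribution /pushforward/= -ZD//.
have ig : (distribution P Z' \x N)%E.-integrable setT (EFin \o g).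
  by apply: bounded_integrable.
rewrite /Rintegral; congr fine.
transitivity (\int[distribution P Q']_p (EFin \o g) p)%E.
  rewrite integral_distribution//.
  apply: (@bounded_integrable _ _ _ P _ M) => //.
  exact: (measurableT_comp mg mZD).
transitivity (\int[distribution P Z' \x N]_p (EFin \o g) p)%E.
  by apply: eq_measure_integral => A mA _; first [exact: QE|exact/esym/QE].
rewrite -integral12_prod_meas1//.
rewrite (fubini_F_EFin _ mg gM) integral_distribution//.
  by apply/measurable_EFinP; exact: (measurable_Rintegral_pair (distribution P
    Z') N mg gM).
apply: (@bounded_integrable _ _ _ P ((fun x => \int[N]_y g (x, y)) \o Z) M).
  by apply: measurableT_comp => //; exact: (measurable_Rintegral_pair
    (distribution P Z') N mg gM).
move=> w; apply: Rintegral_le_bound => //.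
exact: measurable_fun_pair2.
Qed.
End independence.

Section eventually_null.
Context {R : realType} d (Omega : measurableType d) (P : probability Omega R).

(** Dominated convergence of the indicators. This is the bridge from pathwise statements, whose
    threshold depends on the path, to small probabilities. *)
Lemma probability_eventually_le (E : nat -> set Omega) (e : R) :
  (forall n, measurable (E n)) ->
  {ae P, forall w, exists n0, forall n, (n0 <= n)%N -> ~ E n w} -> 0 < e ->
  exists n0, forall n, (n0 <= n)%N -> fine (P (E n)) <= e.
Proof.
move=> mE aE e0.
have m1 n : measurable_fun setT (fun w : Omega => (\1_(E n) w : R)%:E).
  exact/measurable_EFinP.
have i1 : P.-integrable setT (cst 1%E : Omega -> \bar R).
  by apply: (@bounded_integrable _ _ _ P (cst 1) 1) => // x; rewrite normr1.
have cvg0 : {ae P, forall w, setT w ->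
    (\1_(E n) w : R)%:E @[n --> \oo] --> (cst 0%E : Omega -> \bar R) w}.
  apply: filterS aE => w [n0 En0] _.
  apply: cvg_near_cst; exists n0 => // n /= n0n.
  by rewrite indicE memNset//; exact: En0.
have le1 : {ae P, forall w n, setT w ->
    (`|(\1_(E n) w : R)%:E| <= (cst 1%E : Omega -> \bar R) w)%E}.
  by apply: aeW => w n _; rewrite /= lee_fin ger0_norm// indicE.
have [_ _] := @dominated_convergence _ _ _ P setT measurableT
  (fun n w => (\1_(E n) w)%:E) (cst 0%E) (cst 1%E) m1 (measurable_cst _)
  cvg0 i1 le1.
rewrite integral0 => /fine_cvgP[_ /cvgrPdist_le/(_ _ e0)[n0 _ H0]].
exists n0 => n n0n; have := H0 n n0n.
rewrite /= sub0r normrN integral_indic// setIT.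
by rewrite ger0_norm// fine_ge0.
Qed.

End eventually_null.

Section sub_sigma_algebra.
Context {R : realType} d (Omega : measurableType d).
Implicit Types (G : set (set Omega)) (Y : Omega -> R).

(** Measurability on the type equipped with the generated sigma-algebra, so that the usual closure
    rules for measurable functions apply at each time of the filtration. *)
Definition measurable_wrt G Y :=
  measurable_fun setT (Y : g_sigma_algebraType G -> R).

Lemma measurable_wrtP G Y : sigma_algebra setT G ->
  (measurable_wrt G Y <-> forall B, measurable B -> G (Y @^-1` B)).
Proof.
move=> sG; rewrite /measurable_wrt; split => [mY B mB|GY _ B mB].
  have := mY measurableT B mB; rewrite setTI.
  by rewrite measurable_g_measurableTypeE.
by rewrite setTI measurable_g_measurableTypeE//; exact: GY.
Qed.

Lemma measurable_wrt_le G G' Y : sigma_algebra setT G -> sigma_algebra setT G'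
  ->
  G `<=` G' -> measurable_wrt G Y -> measurable_wrt G' Y.
Proof.
move=> sG sG' GG' /measurable_wrtP mY; apply/measurable_wrtP => // B mB.
by apply: GG'; exact: mY.
Qed.

Lemma measurable_wrtT G Y : sigma_algebra setT G -> G `<=` measurable ->
  measurable_wrt G Y -> measurable_fun setT Y.
Proof.
by move=> sG Gm /measurable_wrtP mY _ B mB; rewrite setTI; apply: Gm; exact: mY.
Qed.

End sub_sigma_algebra.

(** * The discretised process *)

Section chain_step.
Context {R : realType} d (Omega : measurableType d) (P : probability Omega R).
Variables (F : R -> set (set Omega)) (W : R -> Omega -> R).
Hypothesis HF : filtration F.
Hypothesis HW : brownian_motion P F W.

(** Test functions for a killed chain: outside [-L, L] the contribution is 0, and [dead] measures
    the mass that has gone there. *)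
Definition cutoff (L : R) (g : R -> R) (z : R) : R := if `|z| <= L then g z
  else 0.

Definition dead (L z : R) : R := if `|z| <= L then 0 else 1.

Lemma measurable_cutoff L (g : R -> R) : measurable_fun setT g ->
  measurable_fun setT (cutoff L g).
Proof.
move=> mg; apply: measurable_fun_ifT => //.
by apply: measurable_fun_ler => //; exact: normr_measurable.
Qed.

Lemma measurable_dead L : measurable_fun setT (dead L).
Proof.
apply: measurable_fun_ifT => //.
by apply: measurable_fun_ler => //; exact: normr_measurable.
Qed.

Lemma dead_le1 L z : `|dead L z| <= 1.
Proof. by rewrite /dead; case: ifP; rewrite ?normr0 ?normr1. Qed.

Lemma normr_cutoff_le L (g : R -> R) M z : 0 <= M -> (forall x, `|g x| <= M) ->
  `|cutoff L g z| <= M.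
Proof. by move=> M0 gM; rewrite /cutoff; case: ifP => //; rewrite normr0. Qed.

Lemma measurable_filtration s (Y : Omega -> R) : 0 <= s ->
  measurable_wrt (F s) Y -> measurable_fun setT Y.
Proof.
move=> s0; apply: measurable_wrtT.
  exact: (filtration_sigma_algebra HF).
exact: (filtration_measurable HF).
Qed.

Lemma measurable_brownian s : 0 <= s -> measurable_wrt (F s) (W s).
Proof.
move=> s0; apply/measurable_wrtP; first exact: (filtration_sigma_algebra HF).
by apply: (brownian_adapted HW); rewrite /= in_itv/= s0.
Qed.

Lemma measurable_increment s r : 0 <= s -> 0 <= r ->
  measurable_fun setT (increment W s r).
Proof.
move=> s0 r0; apply: measurable_funB.
  exact: (measurable_filtration r0 (measurable_brownian r0)).
exact: (measurable_filtration s0 (measurable_brownian s0)).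
Qed.

Lemma increment_expectation s r (Z : Omega -> R) (g : R * R -> R) (M : R) :
  0 <= s -> s < r -> measurable_wrt (F s) Z ->
  measurable_fun setT g -> (forall p, `|g p| <= M) ->
  \int[P]_w g (Z w, increment W s r w) =
  \int[P]_w \int[gauss_prob (r - s)]_y g (Z w, y).
Proof.
move=> s0 sr mZ mg gM; have r0 : 0 <= r by rewrite (le_trans s0)// ltW.
apply: (@indep_expectation _ _ _ P _ _ _ (measurableTypeR R) Z
  (increment W s r) (gauss_prob (r - s)) g M) => //.
- exact: (measurable_filtration s0 mZ).
- exact: measurable_increment.
move=> A B mA mB; rewrite (brownian_independent HW)//.
  by rewrite (brownian_gaussian HW).
move: mZ => /measurable_wrtP; apply => //.
exact: (filtration_sigma_algebra HF).
Qed.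

(** Replacing [Z'] by the Euler point costs [C1 * (eps * (r - s))] by the Lipschitz bound, needed on
    [-L - 1, L + 1] because the Euler point is within distance 1 of [Z']. The increment is then
    integrated out by independence, which costs [C0]. Chains dying in this step cost [M] each, and
    this last term telescopes over the steps. *)
Lemma chain_step (f u u' : R -> R) (s r L eps M C0 C1 : R) (Z Z' : Omega -> R) :
  0 <= s -> s < r -> 0 <= L -> 0 <= eps -> eps * (r - s) <= 1 ->
  measurable_fun setT f -> measurable_fun setT u -> measurable_fun setT u' ->
  (forall x, `|u x| <= M) -> (forall x, `|u' x| <= M) -> 0 <= C0 -> 0 <= C1 ->
  (forall x y, `|x| <= L + 1 -> `|y| <= L + 1 -> `|u' x - u' y| <= C1 * `|x -
    y|) ->
  (forall x, `|x| <= L ->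
    `|\int[gauss_prob (r - s)]_y u' (x + f x * (r - s) + y) - u x| <= C0) ->
  measurable_wrt (F s) Z -> measurable_wrt (F r) Z' ->
  (forall w, `|Z' w| <= L -> `|Z w| <= L /\
    `|Z' w - (Z w + f (Z w) * (r - s) + increment W s r w)| <= eps * (r - s)) ->
  `|\int[P]_w cutoff L u' (Z' w) - \int[P]_w cutoff L u (Z w)| <=
  C0 + C1 * (eps * (r - s))
  + M * (\int[P]_w dead L (Z' w) - \int[P]_w dead L (Z w)).
Proof.
move=> s0 sr L0 eps0 eps1 mf mu mu' uM u'M C00 C10 lip onestep mZ mZ' ZZ'.
have M0 : 0 <= M by rewrite (le_trans _ (uM 0)).
have r0 : 0 <= r by rewrite (le_trans s0)// ltW.
have {}mZ0 := measurable_filtration s0 mZ.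
have {}mZ'0 := measurable_filtration r0 mZ'.
have mD := measurable_increment s0 r0.
pose h z y := u' (z + f z * (r - s) + y).
pose g (p : R * R) : R := if `|p.1| <= L then h p.1 p.2 else 0.
have mg : measurable_fun setT g.
  apply: measurable_fun_ifT => //.
    apply: measurable_fun_ler => //.
    by apply: measurableT_comp => //; exact: normr_measurable.
  apply: (measurableT_comp mu'); apply: measurable_funD => //.
  apply: measurable_funD => //; apply: measurable_funM => //.
  exact: measurableT_comp.
have gM p : `|g p| <= M by rewrite /g; case: ifP; rewrite ?normr0 ?u'M.
have bint (Y : Omega -> R) (k : R -> R) K : measurable_fun setT Y ->
    measurable_fun setT k -> (forall x, `|k x| <= K) ->
    P.-integrable setT (EFin \o (fun w => k (Y w))).
  move=> mY mk kK; apply: (@bounded_integrable _ _ _ P _ K) => //.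
  exact: measurableT_comp.
have icu' := bint _ _ M mZ'0 (measurable_cutoff L mu') (fun z =>
  normr_cutoff_le L z M0 u'M).
have icu := bint _ _ M mZ0 (measurable_cutoff L mu) (fun z => normr_cutoff_le L
  z M0 uM).
have id' := bint _ _ 1 mZ'0 (measurable_dead L) (dead_le1 L).
have id0 := bint _ _ 1 mZ0 (measurable_dead L) (dead_le1 L).
pose G z := \int[gauss_prob (r - s)]_y g (z, y).
have mG : measurable_fun setT G.
  exact: (@measurable_Rintegral_pair _ _ (measurableTypeR R) _ (measurableTypeR
    R)
    (gauss_prob 1) (gauss_prob (r - s)) g M).
have GM z : `|G z| <= M.
  by apply: Rintegral_le_bound => //; exact: measurable_fun_pair2.
have iG := bint _ _ M mZ0 mG GM.
have mgZD : measurable_fun setT (fun w => g (Z w, increment W s r w)).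
  by apply: (measurableT_comp mg); exact: measurable_fun_pair.
have igZD : P.-integrable setT (EFin \o (fun w => g (Z w, increment W s r w))).
  exact: (@bounded_integrable _ _ _ P _ M).
have e1 : `|\int[P]_w cutoff L u' (Z' w) - \int[P]_w g (Z w, increment W s r
  w)| <=
    C1 * (eps * (r - s))
    + M * (\int[P]_w dead L (Z' w) - \int[P]_w dead L (Z w)).
  have ib := integrableB measurableT icu' igZD.
  rewrite -RintegralB// (le_trans (le_normr_Rintegral _ ib))//.
  pose b w := C1 * (eps * (r - s)) + M * (dead L (Z' w) - dead L (Z w)).
  have idd : P.-integrable setT (EFin \o (fun w => dead L (Z' w) - dead L (Z
    w))).
    exact: (integrableB measurableT id' id0).
  have iMdd := integrableZl measurableT M idd.
  have ic : P.-integrable setT (EFin \o cst (C1 * (eps * (r - s)))).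
    exact: (@bounded_integrable _ _ _ P _ `|C1 * (eps * (r - s))|).
  have -> : C1 * (eps * (r - s))
      + M * (\int[P]_w dead L (Z' w) - \int[P]_w dead L (Z w)) = \int[P]_w b w.
    rewrite /b (RintegralD measurableT ic iMdd).
    rewrite Rintegral_cst// [X in fine X]probability_setT mulr1.
    by rewrite (RintegralZl M measurableT idd) RintegralB.
  apply: le_Rintegral => //.
    exact: (integrable_norm ib).
    exact: (integrableD measurableT ic iMdd).
  move=> w _; rewrite /b /dead /cutoff /g/=.
  have ez : 0 <= C1 * (eps * (r - s)).
    by rewrite !mulr_ge0// subr_ge0 ltW.
  (* When [Z'] is dead, either [Z] was alive and the difference of the [dead] terms is 1, or both
     sides of the comparison are 0. *)
  have [Z'L|Z'L] := leP `|Z' w| L; last first.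
    case: ifP => ZL; last by rewrite subrr normr0 subrr mulr0 addr0.
    by rewrite sub0r normrN subr0 mulr1 (le_trans (u'M _))// lerDr.
  have [ZL Z'Z] := ZZ' w Z'L; rewrite ZL subrr mulr0 addr0 /h.
  apply: le_trans (lip _ _ _ _) _.
  - by rewrite (le_trans Z'L)// lerDl.
  - rewrite -(subrK (Z' w) (_ + _ + _)) (le_trans (ler_normD _ _))// addrC
    lerD//.
    by rewrite distrC (le_trans Z'Z).
  - by rewrite ler_wpM2l.
have e2 : `|\int[P]_w g (Z w, increment W s r w) - \int[P]_w cutoff L u (Z w)|
  <= C0.
  rewrite (increment_expectation s0 sr mZ mg gM).
  have <- : \int[P]_w (G (Z w) - cutoff L u (Z w)) =
      \int[P]_w G (Z w) - \int[P]_w cutoff L u (Z w).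
    exact: (RintegralB measurableT iG icu).
  apply: Rintegral_le_bound.
    by apply: measurable_funB; [exact: (measurableT_comp mG)|
      exact: (measurableT_comp (measurable_cutoff L mu))].
  move=> w; rewrite /G /cutoff /g/=; case: ifPn => ZL; first exact: onestep.
  by rewrite Rintegral_cst// mul0r subrr normr0.
rewrite (le_trans (ler_distD (\int[P]_w g (Z w, increment W s r w)) _ _))//.
by rewrite (le_trans (lerD e1 e2))// addrC addrA.
Qed.

End chain_step.

(** * Uniform grids and Riemann sums along a path *)

Section grid_errors.
Context {R : realType}.
Local Notation mu := (@lebesgue_measure R).
Implicit Types (F : R -> R) (A : set R).

Lemma within_continuous_dist A F : {within A, continuous F} ->
  forall x e, A x -> 0 < e -> exists2 dl, 0 < dl &
    forall y, A y -> `|x - y| < dl -> `|F x - F y| <= e.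
Proof.
move=> /subspace_continuousP cF x e Ax e0.
have /cvgrPdist_le/(_ _ e0)[dl /= dl0 H] := cF x Ax.
by exists dl => // y Ay xy; apply: H.
Qed.

(** The Heine-Cantor theorem for continuity relative to the segment, which is all that is known of
    the paths. Compactness is used in its near-covering form, with the modulus as a parameter
    tending to 0 from the right. *)
Lemma segment_uniform_continuous (a b : R) F : {within `[a, b], continuous F} ->
  forall e, 0 < e -> exists2 dl, 0 < dl &
    forall x y, x \in `[a, b] -> y \in `[a, b] -> `|x - y| < dl ->
    `|F x - F y| <= e.
Proof.
move=> cF e e0.
pose Q (dl x : R) := forall y, y \in `[a, b] -> `|x - y| < dl -> `|F x - F y|
  <= e.
have /near_covering_withinP/(_ R (0^'+) Q _) : near_covering `[a, b]%classic.
  by apply/compact_near_coveringP; exact: segment_compact.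
case.
  move=> x xab.
  have [dl dl0 H] := within_continuous_dist cF xab (divr_gt0 e0 (ltr0n R 2)).
  exists (ball x (dl / 2), [set d' | 0 < d' < dl / 2]) => /=.
    split; first by apply: nbhsx_ballx; rewrite divr_gt0.
    by near=> d'; apply/andP; split; near: d';
      [exact: nbhs_right_gt|apply: nbhs_right_lt; rewrite divr_gt0].
  move=> [x' d'] /= [xx' /andP[d'0 d'dl]] x'ab y yab x'y.
  have h1 : `|F x - F x'| <= e / 2.
    by apply: H => //; rewrite (lt_trans xx')// ltr_pdivrMr// ltr_pMr// ltr1n.
  have h2 : `|F x - F y| <= e / 2.
    apply: H => //; rewrite (le_lt_trans (ler_distD x' _ _))// (splitr dl)
      ltrD//.
    exact: lt_trans d'dl.
  by rewrite (le_trans (ler_distD (F x) _ _))// (splitr e) lerD// distrC.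
move=> dl /= dl0 H; exists (dl / 2); first by rewrite divr_gt0.
move=> x y xab yab xy.
apply: (H (dl / 2)) => //=.
- by rewrite sub0r normrN gtr0_norm ?divr_gt0// ltr_pdivrMr// ltr_pMr// ltr1n.
- by rewrite divr_gt0.
Unshelve. all: by end_near. Qed.

Lemma Rintegral_osc_le F (a b c e : R) : a <= b -> 
  mu.-integrable `]a, b] (EFin \o F) ->
  (forall x, x \in `]a, b] -> `|F x - c| <= e) ->
  `|\int[mu]_(x in `]a, b]) F x - c * (b - a)| <= e * (b - a).
Proof.
move=> ab iF Fc.
have muE : mu `]a, b]%classic = (if a < b then (b - a)%:E else 0%E).
  by have := lebesgue_measure_itv `]a, b]; rewrite /= lte_fin.
have fmu : fine (mu `]a, b]%classic) = b - a.
  rewrite muE; have [//|ba] := ltP a b.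
  by rewrite (@le_anti _ _ a b) ?subrr// ab ba.
have ic (r : R) : mu.-integrable `]a, b] (EFin \o cst r).
  apply: measurable_bounded_integrable => //.
    by rewrite [X in (X < _)%E]muE; case: ifP; rewrite ltry.
  exact: bounded_cst.
have -> : c * (b - a) = \int[mu]_(x in `]a, b]) c by rewrite Rintegral_cst//
  fmu.
have mab : measurable (`]a, b]%classic : set (measurableTypeR R)).
  exact: measurable_itv.
have iFc := integrableB mab iF (ic c).
rewrite -RintegralB//; last exact: ic.
rewrite (le_trans (le_normr_Rintegral _ iFc))//.
have -> : e * (b - a) = \int[mu]_(x in `]a, b]) e by rewrite Rintegral_cst//
  fmu.
apply: le_Rintegral => //; first exact: (integrable_norm iFc).
exact: ic.
Qed.

Definition grid (t : R) (n k : nat) : R := k%:R * (t / n.+1%:R).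

Lemma gridS (t : R) n k : grid t n k.+1 = grid t n k + t / n.+1%:R.
Proof. by rewrite /grid -natr1 mulrDl mul1r. Qed.

Lemma grid0 (t : R) n : grid t n 0 = 0. Proof. by rewrite /grid mul0r. Qed.

Lemma gridn (t : R) n : grid t n n.+1 = t.
Proof. by rewrite /grid mulrC divfK. Qed.

Lemma grid_ge0 (t : R) n k : 0 <= t -> 0 <= grid t n k.
Proof. by move=> t0; rewrite /grid mulr_ge0// divr_ge0. Qed.

Lemma grid_le (t : R) n k : 0 <= t -> (k <= n.+1)%N -> grid t n k <= t.
Proof.
move=> t0 kn; rewrite -[leRHS](gridn t n) /grid ler_wpM2r ?divr_ge0//.
by rewrite ler_nat.
Qed.

Lemma grid_step_small (t e : R) : 0 < t -> 0 < e ->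
  exists n0, forall n, (n0 <= n)%N -> t / n.+1%:R < e.
Proof.
move=> t0 e0; exists (Num.truncn (t / e)) => n n0n.
rewrite ltr_pdivrMr// mulrC -ltr_pdivrMr//.
by rewrite (lt_le_trans (truncnS_gt _))// ler_nat.
Qed.

(** Uniform continuity makes [n0] independent of the cell [k]. It still depends on [F], that is on
    the path. *)
Lemma grid_Rintegral_error (t : R) F (e : R) : 0 < t -> 0 < e ->
  {within `[0, t], continuous F} ->
  mu.-integrable `[0, t] (EFin \o F) ->
  exists n0, forall n, (n0 <= n)%N -> forall k, (k <= n)%N ->
    `|\int[mu]_(q in `]grid t n k, grid t n k.+1]) F q
       - F (grid t n k) * (t / n.+1%:R)| <= e * (t / n.+1%:R).
Proof.
move=> t0 e0 cF iF; have [dl dl0 H] := segment_uniform_continuous cF e0.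
have [n0 Hn] := grid_step_small t0 dl0; exists n0 => n n0n k kn.
have st0 : 0 < t / n.+1%:R by rewrite divr_gt0.
have g0 := grid_ge0 n k (ltW t0).
have gt : grid t n k.+1 <= t by apply: grid_le; [exact: ltW|].
have gg : grid t n k <= grid t n k.+1 by rewrite gridS lerDl ltW.
have -> : t / n.+1%:R = grid t n k.+1 - grid t n k by rewrite gridS addrAC
  subrr add0r.
apply: Rintegral_osc_le => //.
  apply: (integrableS _ _ _ iF) => // x /=; rewrite !in_itv/= => /andP[x1 x2].
  by rewrite (le_trans g0 (ltW x1)) (le_trans x2).
move=> x; rewrite in_itv/= => /andP[x1 x2]; apply: H.
- by rewrite in_itv/= (le_trans g0 (ltW x1)) (le_trans x2).
- by rewrite in_itv/= g0 (le_trans gg).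
- rewrite gtr0_norm ?subr_gt0//; apply: le_lt_trans (Hn n n0n).
  by move: x2; rewrite gridS lerBlDl.
Qed.

End grid_errors.

(** * Expectation of a space-time harmonic ratio along the solution *)

Section martingale.
Context {R : realType} d (Omega : measurableType d) (P : probability Omega R).
Variables (F : R -> set (set Omega)) (W X : R -> Omega -> R).
Hypothesis HF : filtration F.
Hypothesis HW : brownian_motion P F W.
Variables (t x0 M : R) (f u : R -> R -> R).
Hypothesis t_gt0 : 0 < t.
Hypothesis mX : forall s : R, 0 <= s <= t -> measurable_wrt (F s) (X s).
Hypothesis X0 : {ae P, forall w, X 0 w = x0}.
Hypothesis cX : {ae P, forall w, {within `[0, t], continuous (fun s : R => X s
  w)}}.
Hypothesis cf : {ae P, forall w,
  {within `[0, t], continuous (fun s : R => f s (X s w))}}.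
Hypothesis inf : {ae P, forall w, (@lebesgue_measure R).-integrable `[0, t]
  (fun s : R => (f s (X s w))%:E)}.
Hypothesis Xeq : {ae P, forall w, forall s : R, 0 <= s <= t ->
  X s w = x0 + (\int[@lebesgue_measure R]_(q in `[0, s]) f q (X q w)) + W s w}.
Hypothesis mf : forall s : R, 0 <= s <= t -> measurable_fun setT (f s).
Hypothesis mu : forall s : R, 0 <= s <= t -> measurable_fun setT (u s).
Hypothesis uM : forall (s x : R), 0 <= s <= t -> `|u s x| <= M.
Hypothesis lip : forall L : R, exists C : R, forall s x y : R, 0 <= s <= t ->
  `|x| <= L -> `|y| <= L -> `|u s x - u s y| <= C * `|x - y|.
Hypothesis step : forall L : R, exists C : R, forall s r x : R, 0 <= s -> s < r
  -> r <= t ->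
  r - s <= 1 -> `|x| <= L ->
  `|\int[gauss_prob (r - s)]_y u r (x + f s x * (r - s) + y) - u s x|
  <= C * ((r - s) * Num.sqrt (r - s)).

Definition scheme_error n k w : R :=
  X (grid t n k.+1) w - (X (grid t n k) w + f (grid t n k) (X (grid t n k) w)
    * (t / n.+1%:R) + increment W (grid t n k) (grid t n k.+1) w).

(* The value [L + 1], outside [[-L, L]], is a cemetery state, entered when the
   path leaves [[-L, L]] or the Euler scheme errs by more than [eps] per unit of
   time. *)
Fixpoint killed (L eps : R) n k w : R :=
  match k with
  | 0%N => if `|X 0 w| <= L then X 0 w else L + 1
  | k'.+1 => if [&& `|killed L eps n k' w| <= L,
                  `|scheme_error n k' w| <= eps * (t / n.+1%:R) &
                  `|X (grid t n k'.+1) w| <= L]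
             then X (grid t n k'.+1) w else L + 1
  end.

(** The union over all finenesses makes the event depend on [L] alone, so that [L] can be fixed
    before the grid is refined; being countable, it is measurable. *)
Definition escape L : set Omega :=
  \bigcup_n \bigcup_(k in [set k | (k <= n.+1)%N]) [set w | L < `|X (grid t n
    k) w|].

Definition inaccurate eps n : set Omega :=
  \bigcup_(k in [set k | (k <= n)%N])
    [set w | eps * (t / n.+1%:R) < `|scheme_error n k w|].

Let gridt n k : (k <= n.+1)%N -> 0 <= grid t n k <= t.
Proof. by move=> kn; rewrite grid_ge0 ?grid_le// ltW. Qed.

Let grid_step n k : grid t n k.+1 - grid t n k = t / n.+1%:R.
Proof. by rewrite gridS addrAC subrr add0r. Qed.

Let step_gt0 n : 0 < t / n.+1%:R. Proof. by rewrite divr_gt0. Qed.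

Let sF (s : R) : 0 <= s -> sigma_algebra setT (F s).
Proof. exact: (filtration_sigma_algebra HF). Qed.

Let measurable_le (s r : R) (Y : Omega -> R) : 0 <= s -> s <= r ->
  measurable_wrt (F s) Y -> measurable_wrt (F r) Y.
Proof.
move=> s0 sr; apply: measurable_wrt_le; [exact: sF|apply: sF|].
  exact: le_trans sr.
exact: (filtration_le HF).
Qed.

Let grid_lt n k : grid t n k < grid t n k.+1.
Proof. by rewrite gridS ltrDl. Qed.

Let measurable_error n k : (k <= n)%N ->
  measurable_wrt (F (grid t n k.+1)) (scheme_error n k).
Proof.
move=> kn; have gk : 0 <= grid t n k <= t by apply: gridt; rewrite ltnW.
have gk1 : 0 <= grid t n k.+1 <= t by exact: gridt.
have [gk0 _] := andP gk; have [gk10 _] := andP gk1.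
have mXk : measurable_wrt (F (grid t n k.+1)) (X (grid t n k)).
  by apply: measurable_le (mX gk) => //; exact: ltW.
apply: measurable_funB; first exact: mX.
apply: measurable_funD.
  apply: measurable_funD => //; apply: measurable_funM => //.
  exact: (measurableT_comp (mf gk) mXk).
apply: measurable_funB; first exact: (measurable_brownian HF HW).
apply: (measurable_le gk0); first exact: ltW.
exact: (measurable_brownian HF HW).
Qed.

Let measurable_killed L eps n k : (k <= n.+1)%N ->
  measurable_wrt (F (grid t n k)) (killed L eps n k).
Proof.
elim: k => [|k IH] kn /=.
  apply: measurable_fun_ifT => //; last by rewrite grid0; apply: mX; rewrite
    lexx ltW.
  apply: measurable_fun_ler => //; apply: measurableT_comp => //.
  by rewrite grid0; apply: mX; rewrite lexx ltW.
have gk1 := gridt kn.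
apply: measurable_fun_ifT => //; last exact: mX.
apply: measurable_and; last apply: measurable_and.
- apply: measurable_fun_ler => //; apply: measurableT_comp => //.
  apply: (measurable_le (s := grid t n k)); last by apply: IH; rewrite ltnW.
    by apply: grid_ge0; exact: ltW.
  exact: ltW.
- apply: measurable_fun_ler => //; apply: measurableT_comp => //.
  exact: measurable_error.
- apply: measurable_fun_ler => //; apply: measurableT_comp => //.
  exact: mX.
Qed.

Let killedE L eps n k w : 0 <= L -> `|killed L eps n k w| <= L ->
  killed L eps n k w = X (grid t n k) w.
Proof.
move=> L0; have LN : `|L + 1| <= L -> False.
  by rewrite ger0_norm ?addr_ge0//; rewrite gerDl ler10.
case: k => [|k] /=; first by rewrite grid0; case: ifP => // _ /LN.
by case: ifP => // _ /LN.
Qed.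

Let killed_step L eps n k w : 0 <= L -> `|killed L eps n k.+1 w| <= L ->
  `|killed L eps n k w| <= L /\
  `|killed L eps n k.+1 w - (killed L eps n k w
     + f (grid t n k) (killed L eps n k w) * (t / n.+1%:R)
     + increment W (grid t n k) (grid t n k.+1) w)| <= eps * (t / n.+1%:R).
Proof.
move=> L0 /=; case: ifP => [/and3P[kL eL XL] _|_].
  by split => //; rewrite (killedE L0 kL).
by rewrite ger0_norm ?addr_ge0//; rewrite gerDl ler10.
Qed.

Let killed_alive L eps n k w : (k <= n.+1)%N -> ~ escape L w ->
  ~ inaccurate eps n w -> `|killed L eps n k w| <= L.
Proof.
move=> kn Ew Iw.
have XL j : (j <= n.+1)%N -> `|X (grid t n j) w| <= L.
  move=> jn; rewrite leNgt; apply/negP => LX; apply: Ew.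
  by exists n => //; exists j.
have eL j : (j <= n)%N -> `|scheme_error n j w| <= eps * (t / n.+1%:R).
  by move=> jn; rewrite leNgt; apply/negP => LX; apply: Iw; exists j.
have := XL 0%N isT; rewrite grid0 => X0L.
elim: k kn => [|k IH] kn /=; first by rewrite X0L.
by rewrite IH ?(ltnW kn)// eL// XL//= XL.
Qed.

Let measurable_ltr_set (Y : Omega -> R) (c : R) : measurable_fun setT Y ->
  measurable [set w | c < `|Y w|].
Proof.
move=> mY; have mlt : measurable_fun setT (fun w => c < `|Y w|).
  by apply: measurable_fun_ltr => //; exact: measurableT_comp.
by rewrite -[X in measurable X]setTI; exact: (mlt measurableT [set true]).
Qed.

Let measurable_escape L : measurable (escape L).
Proof.
apply: bigcup_measurable => n _; apply: bigcup_measurable => k /= kn.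
have gk := gridt kn; have [gk0 _] := andP gk.
exact: measurable_ltr_set (measurable_filtration HF gk0 (mX gk)).
Qed.

Let measurable_inaccurate eps n : measurable (inaccurate eps n).
Proof.
apply: bigcup_measurable => k /= kn; apply: measurable_ltr_set.
apply: (measurable_filtration HF _ (measurable_error kn)).
by apply: grid_ge0; exact: ltW.
Qed.

(** A continuous path is bounded on the compact interval [0, t]. *)
Let escape_null : {ae P, forall w, exists n0 : nat, forall n : nat,
  (n0 <= n)%N -> ~ escape n%:R w}.
Proof.
apply: filterS cX => w cw.
have [B XB] : exists B, forall s, 0 <= s <= t -> `|X s w| <= B.
  have := continuous_compact cw (@segment_compact _ 0 t).
  move=> /compact_bounded[B [_ HB]]; exists (B + 1) => s st.
  by apply: (HB (B + 1)); [rewrite ltrDl|exists s => //; rewrite /= in_itv].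
exists (Num.truncn `|B|).+1 => n n0n [m _ [k /= km]].
apply/negP; rewrite -leNgt (le_trans (XB _ (gridt km)))//.
rewrite (le_trans (ler_norm _))// (le_trans (ltW (truncnS_gt _)))//.
by rewrite ler_nat.
Qed.

(** In the scheme error the integral equation cancels [x0] and [W]. What remains is the integral of
    the drift over one cell minus its left Riemann term. *)
Let inaccurate_null eps : 0 < eps -> {ae P, forall w, exists n0 : nat,
  forall n : nat, (n0 <= n)%N -> ~ inaccurate eps n w}.
Proof.
move=> eps0; move: cf inf Xeq.
apply: filterS3 => w cw iw Xw.
have [n0 Hn] := grid_Rintegral_error t_gt0 eps0 cw iw.
exists n0 => n n0n [k /= kn]; apply/negP; rewrite -leNgt.
apply: le_trans (Hn n n0n k kn).
have gk := gridt (leqW kn); have [gk0 gkt] := andP gk.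
have gk1 : 0 <= grid t n k.+1 <= t by exact: gridt.
have [gk10 gk1t] := andP gk1.
have iw1 : (@lebesgue_measure R).-integrable `[0, grid t n k.+1]
    (EFin \o (fun s => f s (X s w))).
  apply: (integrableS _ _ _ iw) => // y /=; rewrite !in_itv/= => /andP[-> y1].
  by rewrite (le_trans y1).
rewrite -(Rintegral_itvB iw1) ?bnd_simp ?(ltW (grid_lt _ _))//.
rewrite le_eqVlt; apply/orP; left; apply/eqP; congr `| _ |.
rewrite /scheme_error /increment; set fx := f _ _ * _.
by rewrite (Xw _ gk) (Xw _ gk1); ring.
Qed.

Let PN : fine (P setT) = 1. Proof. by rewrite probability_setT. Qed.

Let bounded_int (g : Omega -> R) K : measurable_fun setT g ->
  (forall w, `|g w| <= K) -> P.-integrable setT (EFin \o g).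
Proof. exact: bounded_integrable. Qed.

Let M_ge0 : 0 <= M.
Proof. by rewrite (le_trans _ (@uM 0 0 _))// lexx ltW. Qed.

Let dead_killed_le L eps n :
  \int[P]_w dead L (killed L eps n n.+1 w) <=
  fine (P (escape L)) + fine (P (inaccurate eps n)).
Proof.
have gn := gridt (leqnn n.+1); have [gn0 _] := andP gn.
have mK := measurable_filtration HF gn0 (measurable_killed L eps (leqnn n.+1)).
have PI (A : set Omega) : measurable A -> fine (P A) = \int[P]_w (\1_A w : R).
  by move=> mA; rewrite /Rintegral integral_indic// setIT.
have i1 (A : set Omega) : measurable A -> P.-integrable setT (EFin \o (\1_A :
  Omega -> R)).
  move=> mA; apply: (bounded_int (K := 1)) => // w.
  by rewrite indicE ger0_norm//; case: (w \in A).
rewrite !PI// -RintegralD//; [|exact: i1|exact: i1].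
apply: le_Rintegral => //.
- apply: (bounded_int (K := 1)); last by move=> w; exact: dead_le1.
  exact: (measurableT_comp (measurable_dead L)).
- exact: (integrableD measurableT (i1 _ (measurable_escape L))
    (i1 _ (measurable_inaccurate eps n))).
move=> w _; rewrite /dead !indicE.
have [wE|wE] := boolP (w \in escape L).
  by case: ifP => _; rewrite ?lerDl ?addr_ge0.
have [wI|wI] := boolP (w \in inaccurate eps n).
  by case: ifP => _; rewrite ?lerDr ?addr_ge0.
rewrite killed_alive// ?addr0//.
- by move/mem_set; apply/negP.
- by move/mem_set; apply/negP.
Qed.

(** The constants depend on [L] but not on [eps] or [n]. Summing [n.+1] local errors of order
    dt^(3/2) gives [t] times the square root of the step. One [M] pays for the chains killed on the
    way, the other for replacing the final state of the killed chain by [X t]. *)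
Lemma killed_bound (L : R) : exists C0 C1 : R, [/\ 0 <= C0, 0 <= C1 &
  forall (eps : R) n, `|x0| <= L -> 0 <= eps -> eps <= 1 -> t / n.+1%:R <= 1 ->
  `|\int[P]_w u t (X t w) - u 0 x0| <=
  t * (C0 * Num.sqrt (t / n.+1%:R) + C1 * eps)
  + 2 * M * (fine (P (escape L)) + fine (P (inaccurate eps n)))].
Proof.
have [C0' HC0] := step L; have [C1' HC1] := lip (L + 1).
exists `|C0'|, `|C1'|; split => // eps n x0L eps0 eps1 dt1.
have L0 : 0 <= L by rewrite (le_trans _ x0L).
pose dt := t / n.+1%:R; have dt0 : 0 < dt by exact: step_gt0.
pose Z := killed L eps n.
pose a k := \int[P]_w cutoff L (u (grid t n k)) (Z k w).
pose q k := \int[P]_w dead L (Z k w).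
have stepk k : (k <= n)%N -> `|a k.+1 - a k| <=
    `|C0'| * (dt * Num.sqrt dt) + `|C1'| * (eps * dt) + M * (q k.+1 - q k).
  move=> kn; have gk := gridt (leqW kn); have [gk0 gkt] := andP gk.
  have gk1 : 0 <= grid t n k.+1 <= t by exact: gridt.
  have [gk10 gk1t] := andP gk1.
  have E := grid_step n k; rewrite -/dt in E; rewrite -E.
  apply: (chain_step HF HW (f := f (grid t n k)) (M := M)) => //.
  - by rewrite E mulr_ile1// ltW.
  - exact: mf.
  - exact: mu.
  - exact: mu.
  - by move=> x; exact: uM.
  - by move=> x; exact: uM.
  - by rewrite mulr_ge0// mulr_ge0 ?sqrtr_ge0// E ltW.
  - move=> x y xL yL; apply: le_trans (HC1 _ _ _ gk1 xL yL) _.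
    by rewrite ler_wpM2r// ler_norm.
  - move=> x xL; apply: le_trans (HC0 _ _ _ gk0 (grid_lt n k) gk1t _ xL) _.
      by rewrite E.
    by rewrite ler_wpM2r ?ler_norm// mulr_ge0 ?sqrtr_ge0// E ltW.
  - exact: (measurable_killed L eps (leqW kn)).
  - by have := @measurable_killed L eps n k.+1 kn.
  - by move=> w ZL; rewrite E; exact: killed_step.
(* The masses [q] telescope, so killing is paid once and not once per step. *)
have sum k : (k <= n.+1)%N -> `|a k - a 0%N| <= 
    k%:R * (`|C0'| * (dt * Num.sqrt dt) + `|C1'| * (eps * dt)) + M * (q k - q
      0%N).
  elim: k => [_|k IH kn]; first by rewrite !subrr normr0 mul0r mulr0 addr0.
  rewrite (le_trans (ler_distD (a k) _ _))// (le_trans (lerD (stepk k kn) (IH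
    (ltnW kn))))//.
  by rewrite -natr1 le_eqVlt; apply/orP; left; apply/eqP; ring.
have gn := gridt (leqnn n.+1); have [gn0 _] := andP gn.
have mKn := measurable_filtration HF gn0 (measurable_killed L eps (leqnn n.+1)).
have tt : 0 <= t <= t by rewrite (ltW t_gt0) lexx.
have t00 : 0 <= (0 : R) <= t by rewrite lexx (ltW t_gt0).
have [t0' _] := andP tt.
have mXt := measurable_filtration HF t0' (mX tt).
have q0 : 0 <= q 0%N.
  by apply: Rintegral_ge0 => w _; rewrite /dead; case: ifP.
have a0E : a 0%N = u 0 x0.
  have -> : u 0 x0 = \int[P]_w (u 0 x0) by rewrite Rintegral_cst// PN mulr1.
  rewrite /a /Rintegral; congr fine; apply: ae_eq_integral => //.
    apply/measurable_EFinP; rewrite grid0.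
    apply: (measurableT_comp (measurable_cutoff L (mu t00))).
    have := measurable_killed L eps (leq0n n.+1); rewrite grid0.
    exact: (measurable_filtration HF (lexx 0)).
  apply: filterS X0 => w Xw _; rewrite grid0 /Z /= Xw x0L /cutoff x0L//.
have qn := dead_killed_le L eps n; rewrite -/Z -/(q _) in qn.
have icut : P.-integrable setT (EFin \o (fun w => cutoff L (u t) (Z n.+1 w))).
  apply: (bounded_int (K := M)).
    exact: (measurableT_comp (measurable_cutoff L (mu tt))).
  by move=> w; apply: normr_cutoff_le => // x; exact: uM.
have iut : P.-integrable setT (EFin \o (fun w => u t (X t w))).
  apply: (bounded_int (K := M)); first exact: (measurableT_comp (mu tt)).
  by move=> w; exact: uM.
have idead : P.-integrable setT (EFin \o (fun w => dead L (Z n.+1 w))).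
  apply: (bounded_int (K := 1)); last by move=> w; exact: dead_le1.
  exact: (measurableT_comp (measurable_dead L)).
(* A chain still alive at the end agrees with the solution. *)
have an : `|\int[P]_w u t (X t w) - a n.+1| <= M * q n.+1.
  rewrite /a gridn -RintegralB//.
  have ib := integrableB measurableT iut icut.
  rewrite (le_trans (le_normr_Rintegral _ ib))//.
  rewrite /q -RintegralZl//; apply: le_Rintegral => //.
  - exact: (integrable_norm ib).
  - exact: (integrableZl measurableT M idead).
  move=> w _; rewrite /cutoff /dead; case: ifPn => ZL.
    by rewrite /Z (killedE L0 ZL) gridn subrr normr0 mulr0.
  by rewrite subr0 mulr1 uM.
have tE : n.+1%:R * dt = t by rewrite /dt mulrC divfK.
have sn := sum n.+1 (leqnn _); rewrite a0E in sn.
rewrite (le_trans (ler_distD (a n.+1) _ _))// (le_trans (lerD an sn))//.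
have -> : n.+1%:R * (`|C0'| * (dt * Num.sqrt dt) + `|C1'| * (eps * dt)) =
    t * (`|C0'| * Num.sqrt dt + `|C1'| * eps) by rewrite -tE; ring.
rewrite addrCA lerD2l -mulrDr -mulrA mulrCA ler_wpM2l//.
by lra.
Qed.

(** The order of choices matters: first [L], making escape unlikely; this fixes [C0] and [C1]; then
    [eps]; and last the fineness [n], since the accuracy threshold depends on [eps]. Each of the
    four errors gets [e / 4]. *)
Theorem expectation_space_time_harmonic : \int[P]_w u t (X t w) = u 0 x0.
Proof.
apply/eqP; rewrite -subr_eq0 -normr_le0; apply/ler_addgt0Pr => e e0; rewrite
  add0r.
have M1 : 0 < 2 * M + 1 by rewrite ltr_wpDl// mulr_ge0.
have e4 : 0 < e / 4 by rewrite divr_gt0.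
have d0 : 0 < e / 4 / (2 * M + 1) by rewrite divr_gt0.
have [l Hl] := probability_eventually_le (fun n => measurable_escape n%:R)
  escape_null d0.
pose l' := maxn l (Num.truncn `|x0|).+1.
have x0L : `|x0| <= l'%:R.
  by rewrite (le_trans (ltW (truncnS_gt _)))// ler_nat leq_maxr.
have {}Hl := Hl l' (leq_maxl _ _).
have [C0 [C1 [C00 C10 H]]] := killed_bound l'%:R.
pose eps := Num.min 1 (e / 4 / (t * C1 + 1)).
have tC1 : 0 < t * C1 + 1 by rewrite ltr_wpDl// mulr_ge0// ltW.
have eps0 : 0 < eps by rewrite lt_min ltr01 divr_gt0.
have eps1 : eps <= 1 by rewrite ge_min lexx.
have epse : eps <= e / 4 / (t * C1 + 1) by rewrite ge_min lexx orbT.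
have [n1 Hn1] := probability_eventually_le (measurable_inaccurate eps)
  (inaccurate_null eps0) d0.
have tC0 : 0 < t * C0 + 1 by rewrite ltr_wpDl// mulr_ge0// ltW.
(* The square root of the step enters the bound, so the step itself is taken below [del ^+ 2]. *)
pose del := Num.min 1 (e / 4 / (t * C0 + 1)).
have del0 : 0 < del by rewrite lt_min ltr01 divr_gt0.
have [n2 Hn2] := grid_step_small t_gt0 (exprn_gt0 2 del0).
pose n := maxn n1 n2.
have {}Hn1 := Hn1 n (leq_maxl _ _).
have {}Hn2 := ltW (Hn2 n (leq_maxr _ _)).
have sq : Num.sqrt (t / n.+1%:R) <= del.
  by rewrite (le_trans (ler_wsqrtr Hn2))// sqrtr_sqr gtr0_norm.
have dt1 : t / n.+1%:R <= 1.
  by rewrite (le_trans Hn2)// exprn_ile1 ?(ltW del0)// ge_min lexx.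
apply: le_trans (H eps n x0L (ltW eps0) eps1 dt1) _.
have h1 : 2 * M * (fine (P (escape l'%:R)) + fine (P (inaccurate eps n))) <= e
  / 4 + e / 4.
  rewrite (@le_trans _ _ (2 * M * (e / 4 / (2 * M + 1) + e / 4 / (2 * M +
    1))))//.
    by rewrite ler_wpM2l ?mulr_ge0// lerD.
  rewrite mulrDr; set y := e / 4 / _.
  have -> : e / 4 = (2 * M + 1) * y by rewrite /y [RHS]mulrC divfK// gt_eqF.
  by rewrite lerD// ler_wpM2r ?(ltW d0)// lerDl.
have h2 : t * (C0 * Num.sqrt (t / n.+1%:R)) <= e / 4.
  rewrite mulrA (@le_trans _ _ ((t * C0 + 1) * (e / 4 / (t * C0 + 1))))//; last
    first.
    by rewrite [leLHS]mulrC divfK// gt_eqF.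
  apply: ler_pM => //; first by rewrite mulr_ge0// ltW.
    by rewrite lerDl.
  by rewrite (le_trans sq)// ge_min lexx orbT.
have h3 : t * (C1 * eps) <= e / 4.
  rewrite mulrA (@le_trans _ _ ((t * C1 + 1) * (e / 4 / (t * C1 + 1))))//; last
    first.
    by rewrite [leLHS]mulrC divfK// gt_eqF.
  apply: ler_pM => //; rewrite ?(ltW eps0)//; first by rewrite mulr_ge0// ltW.
  by rewrite lerDl.
by rewrite mulrDr; lra.
Qed.

End martingale.

(** * The heat kernel and the function Phi *)

Section Phi_facts.
Context {R : realType}.
Local Notation mu := (@lebesgue_measure R).
Implicit Types (x y c sg : R).

Lemma integrable_gauss c : 0 < c -> mu.-integrable setT (EFin \o gauss c).
Proof.
move=> c0; have := @integrable_normal_pdf R 0 (Num.sqrt c).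
by apply: eq_integrable => // x _; rewrite /= normal_pdf_gauss// subr0.
Qed.

Lemma phi_gauss x : phi x = gauss 1 x.
Proof. by rewrite /phi -[X in normal_pdf _ X]sqrtr1 normal_pdf_gauss// subr0.
  Qed.

Lemma PhiEFin x : (Phi x)%:E = (\int[mu]_(s in `]-oo, x]) (gauss 1 s)%:E)%E.
Proof.
rewrite /Phi fineK; first by apply: eq_integral => s _; rewrite phi_gauss.
apply: integrable_fin_num => //.
rewrite (_ : (fun s => _) = EFin \o gauss 1).
  by apply: (integrableS measurableT) => //; exact: integrable_gauss.
by apply/funext => s; rewrite /= phi_gauss.
Qed.

Lemma Phi_ge0 x : 0 <= Phi x.
Proof.
by rewrite -lee_fin PhiEFin integral_ge0// => s _; rewrite lee_fin gauss_ge0.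
Qed.

Lemma Phi_le1 x : Phi x <= 1.
Proof.
rewrite -lee_fin PhiEFin -(integral_gauss 0 (ltr01 : 0 < (1 : R))).
under [leRHS]eq_integral do rewrite subr0.
apply: ge0_subset_integral => //.
- by apply/measurable_EFinP; exact: measurable_gauss.
- by move=> s _; rewrite lee_fin gauss_ge0.
Qed.

Lemma is_derive_Phi x : is_derive x 1 (@Phi R) (gauss 1 x).
Proof.
have [] := @continuous_FTC1 R (gauss 1) -oo%O x (x + 1).
- by rewrite ltrDl.
- by apply: (integrableS measurableT) => //; exact: integrable_gauss.
- by rewrite ltNyr.
- exact: continuous_gauss.
rewrite derive1E (_ : (fun _ => _) = @Phi R); last first.
  apply/funext => y; apply: eq_Rintegral => s _; exact/esym/phi_gauss.
by move=> dx <-; exact: DeriveDef.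
Qed.

Lemma continuous_Phi : continuous (@Phi R).
Proof. exact: is_derive_cont is_derive_Phi. Qed.

(** The mass of [x - 1, x] alone suffices, by the mean value theorem. The bound is crude but has the
    right quadratic rate in the exponent, which is what the comparison with the heat kernel
    needs. *)
Lemma Phi_lower x : gauss 1 (`|x| + 1) <= Phi x.
Proof.
have x1 : x - 1 < x by rewrite gtrDl ltrN10.
have [z zx E] := @MVT R (@Phi R) (gauss 1) (x - 1) x x1
  (fun y _ => is_derive_Phi y) (continuous_subspaceT continuous_Phi).
have : Phi x >= gauss 1 z.
  move/eqP: E; rewrite opprB addrCA subrr addr0 mulr1 subr_eq => /eqP ->.
  by rewrite lerDl Phi_ge0.
apply: le_trans; rewrite /gauss ler_pM2r; last first.
  by rewrite invr_gt0 sqrtr_gt0 !mulr_gt0 ?pi_gt0.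
rewrite ler_expR lerN2 ler_pM2r ?invr_gt0// -[z ^+ 2]real_normK ?num_real//.
rewrite lerXn2r ?nnegrE ?addr_ge0//.
move: zx; rewrite in_itv/= => /andP[z1 z2].
rewrite ler_norml; have := ler_norm x; have := ler_norm (- x); rewrite normrN.
by lra.
Qed.

Lemma Phi_gt0 x : 0 < Phi x.
Proof. by rewrite (lt_le_trans _ (Phi_lower x))// gauss_gt0. Qed.

Lemma Phi_le x y : x <= y -> Phi x <= Phi y.
Proof.
move=> xy; rewrite -lee_fin !PhiEFin; apply: ge0_subset_integral => //.
- by apply/measurable_EFinP/measurable_funTS; exact: measurable_gauss.
- by move=> s _; rewrite lee_fin gauss_ge0.
- by move=> s /=; rewrite !in_itv/= => /le_trans; exact.
Qed.

Lemma gauss_scale c x : 0 < c ->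
  gauss 1 (x / Num.sqrt c) / Num.sqrt c = gauss c x.
Proof.
move=> c0; rewrite /gauss -mulrA -invfM -sqrtrM ?mulr_ge0 ?pi_ge0//.
rewrite exprMn exprVn sqr_sqrtr ?ltW// mulr1.
congr (expR _ / Num.sqrt _); last by rewrite mulr1.
by field; rewrite gt_eqF.
Qed.

Lemma gauss_sign sg c x : sg ^+ 2 = 1 -> gauss c (sg * x) = gauss c x.
Proof. by move=> sg1; rewrite /gauss exprMn sg1 mul1r. Qed.

(** A superposition of Gaussian kernels over a half-line that depends neither on the variance nor on
    the sign. The harmonicity of h thus reduces to that of the kernels. *)
Lemma Phi_scale sg c x : sg ^+ 2 = 1 -> 0 < c ->
  (Phi (sg * x / Num.sqrt c))%:E =
  (\int[mu]_(l in `]-oo, 0%R]) (gauss c (x + sg * l))%:E)%E.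
Proof.
move=> sg1 c0; pose F (l : R) := (l + sg * x) / Num.sqrt c.
have s0 : 0 < Num.sqrt c by rewrite sqrtr_gt0.
have dF (l : R) : is_derive l 1 F (Num.sqrt c)^-1.
  by apply: is_derive_eq; rewrite /GRing.scale/=; ring.
have F'E : F^`()%classic = cst (Num.sqrt c)^-1.
  by apply/funext => l; rewrite derive1E; have := dF l => ?; rewrite derive_val.
have -> : sg * x / Num.sqrt c = F 0 by rewrite /F add0r.
rewrite PhiEFin increasing_ge0_integration_by_substitutionNy.
- apply: eq_integral => l _; rewrite F'E; congr EFin.
  rewrite [LHS]gauss_scale// -[RHS](gauss_sign c _ sg1); congr gauss.
  by rewrite mulrDr mulrA -expr2 sg1 mul1r addrC.
- by move=> p q _ _ pq; rewrite ltr_pM2r ?invr_gt0// ltrD2r.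
- by rewrite F'E => p _; exact: cst_continuous.
- by rewrite F'E; exact: is_cvg_cst.
- by rewrite F'E; exact: cvg_cst.
- split; first by move=> p _; have [] := dF p.
  apply: cvg_at_left_filter; exact: (is_derive_cont dF).
- apply/gt0_cvgMlNy; first by rewrite invr_gt0.
  exact: cvg_addrr_Ny.
- exact/continuous_subspaceT/continuous_gauss.
- by move=> p _; exact: gauss_ge0.
Qed.

End Phi_facts.

(** * Space-time harmonicity of the kernel and of h *)

Section heat_kernel.
Context {R : realType}.
Implicit Types (a c k m s t x y L sg T : R).

Lemma is_derive_gauss c x : 0 < c ->
  is_derive x 1 (gauss c) (- (x / c) * gauss c x).
Proof.
move=> c0.
have dq : is_derive x 1 (fun y : R => - (y ^+ 2 / (2 * c))) (- (x / c)).
  by apply: is_derive_eq; rewrite /GRing.scale/=; field; rewrite gt_eqF.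
have de : is_derive x 1 (fun y : R => expR (- (y ^+ 2 / (2 * c))))
    (expR (- (x ^+ 2 / (2 * c))) * (- (x / c))).
  exact: is_derive1_comp.
by apply: is_derive_eq; rewrite /gauss /GRing.scale/=; ring.
Qed.

(** The backward heat kernel with pole at time [a] and place [m]. The weight [k] lets one family
    serve both as v, with [k = 1], and as the space derivative of h, with [k] the sign. The next
    three definitions are its space derivatives, written with products in place of powers so that
    the tactic [locally_bounded] can take them apart. *)
Definition heat_kernel a m k s x : R := k * gauss (a - s) (x - m).
Definition heat_kernel1 a m k s x : R :=
  - ((x - m) * (a - s)^-1) * heat_kernel a m k s x.
Definition heat_kernel2 a m k s x : R :=
  ((x - m) * (a - s)^-1 * ((x - m) * (a - s)^-1) - (a - s)^-1)
  * heat_kernel a m k s x.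
Definition heat_kernel3 a m k s x : R :=
  (3 * ((a - s)^-1 * ((x - m) * (a - s)^-1))
   - (x - m) * (a - s)^-1 * ((x - m) * (a - s)^-1) * ((x - m) * (a - s)^-1))
  * heat_kernel a m k s x.

Lemma smooth_heat_kernel t a m k : t < a ->
  smooth_family t (heat_kernel a m k) (heat_kernel1 a m k)
    (heat_kernel2 a m k) (heat_kernel3 a m k).
Proof.
move=> ta; have at0 : 0 < a - t by rewrite subr_gt0.
have as0 s : 0 <= s <= t -> 0 < a - s.
  by move=> /andP[_ st]; rewrite subr_gt0 (le_lt_trans st).
have b0 : globally_bounded t (heat_kernel a m k).
  exists (`|k| * gauss (a - t) 0) => s x st; rewrite normrM ler_wpM2l//.
  rewrite ger0_norm ?gauss_ge0// (le_trans (gauss_le _ (as0 s st)))//.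
  rewrite /gauss expr0n/= !mul0r oppr0 expR0 !mul1r lef_pV2.
  - rewrite ler_wsqrtr// ler_wpM2l ?mulr_ge0 ?pi_ge0//.
    by rewrite lerD2l lerN2; case/andP: st.
  - by rewrite posrE sqrtr_gt0 !mulr_gt0 ?pi_gt0// as0.
  - by rewrite posrE sqrtr_gt0 !mulr_gt0 ?pi_gt0.
have b1 := globally_boundedW b0.
have bV : locally_bounded t (fun s x => (a - s)^-1).
  move=> L; exists (a - t)^-1 => s x st _.
  rewrite gtr0_norm ?invr_gt0 ?as0// lef_pV2 ?posrE// ?as0//.
  by rewrite lerD2l lerN2; case/andP: st.
have bx : locally_bounded t (fun s x => x - m).
  move=> L; exists (L + `|m|) => s x st xL.
  by rewrite (le_trans (ler_normB _ _))// lerD.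
have dk s x : 0 <= s <= t ->
    is_derive x 1 (heat_kernel a m k s) (heat_kernel1 a m k s x).
  move=> st; have dg := is_derive_gauss (x - m) (as0 s st).
  have dxm : is_derive x 1 (fun y : R => y - m) 1.
    by apply: is_derive_eq; rewrite oppr0 addr0.
  have dgm := @is_derive1_comp R _ (fun y : R => y - m) x _ _ dg dxm.
  apply: is_derive_eq.
  by rewrite /heat_kernel1 /heat_kernel /GRing.scale/=; ring.
split=> //.
- by rewrite /heat_kernel1; locally_bounded.
- by rewrite /heat_kernel2; locally_bounded.
- by rewrite /heat_kernel3; locally_bounded.
- move=> s x st; have := dk s x st => ?.
  apply: is_derive_eq.
  by rewrite /heat_kernel2 /heat_kernel1 /GRing.scale/=; ring.
- move=> s x st; have := dk s x st => ?.
  apply: is_derive_eq.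
  by rewrite /heat_kernel3 /heat_kernel1 /GRing.scale/=; ring.
Qed.

(** The Chapman-Kolmogorov equation: the variances [a - r] and [r - s] add up to [a - s]. *)
Lemma heat_semigroup_kernel t a m k : t < a ->
  heat_semigroup t (heat_kernel a m k).
Proof.
move=> ta s r x s0 sr rt.
have rs0 : 0 < r - s by rewrite subr_gt0.
have ar0 : 0 < a - r by rewrite subr_gt0 (le_lt_trans rt).
have ig : (gauss_prob (r - s)).-integrable setT
    (EFin \o (fun y : R => gauss (a - r) (x - m + y))).
  apply: (@bounded_integrable _ _ _ _ _ (gauss (a - r) 0)).
    apply: (measurableT_comp (measurable_gauss _)).
    exact: measurable_funD.
  by move=> y; rewrite ger0_norm ?gauss_ge0// gauss_le.
rewrite /heat_kernel.
transitivity (k * \int[gauss_prob (r - s)]_y gauss (a - r) (x - m + y)).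
  rewrite /Rintegral integral_gauss_convolution//=.
  by rewrite addrA subrK.
rewrite -(RintegralZl k measurableT ig); apply: eq_Rintegral => y _.
by rewrite addrAC.
Qed.

Definition heat_Phi sg T s x : R := Phi (sg * x / Num.sqrt (T - s)).

(** The derivative of h is again a heat kernel, with pole at time [T] and place 0. Hence it is
    harmonic too, as [one_step] requires of [h1]. *)
Lemma is_derive_heat_Phi sg T s x : sg ^+ 2 = 1 -> s < T ->
  is_derive x 1 (heat_Phi sg T s) (heat_kernel T 0 sg s x).
Proof.
move=> sg1 sT; have Ts0 : 0 < T - s by rewrite subr_gt0.
have dl : is_derive x 1 (fun y : R => sg * y / Num.sqrt (T - s))
    (sg / Num.sqrt (T - s)).
  by apply: is_derive_eq; rewrite /GRing.scale/=; ring.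
have := is_derive1_comp (is_derive_Phi _) dl.
congr (is_derive x 1 _ _).
rewrite /heat_kernel subr0 -(gauss_sign (T - s) x sg1) -(gauss_scale _ Ts0).
by ring.
Qed.

Lemma heat_Phi_gt0 sg T s x : 0 < heat_Phi sg T s x.
Proof. exact: Phi_gt0. Qed.

Lemma heat_Phi_le1 sg T s x : heat_Phi sg T s x <= 1.
Proof. exact: Phi_le1. Qed.

Lemma smooth_heat_Phi sg T t : sg ^+ 2 = 1 -> t < T ->
  smooth_family t (heat_Phi sg T) (heat_kernel T 0 sg) (heat_kernel1 T 0 sg)
    (heat_kernel2 T 0 sg).
Proof.
move=> sg1 tT; have [b0 b1 b2 _ d0 d1 _] := smooth_heat_kernel 0 sg tT.
split=> //.
- exists 1 => s x _; rewrite ger0_norm ?heat_Phi_le1//.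
  exact/ltW/heat_Phi_gt0.
- exact: globally_boundedW.
- move=> s x /andP[_ st]; apply: is_derive_heat_Phi => //.
  exact: le_lt_trans tT.
Qed.

Lemma normr_sqr1 sg : sg ^+ 2 = 1 -> `|sg| = 1.
Proof.
move=> sg1; apply/eqP; rewrite -(@eqrXn2 _ 2)// -normrX sg1 normr1 expr1n//.
Qed.

Lemma locally_bounded_heat_PhiV sg T t : sg ^+ 2 = 1 -> t < T ->
  locally_bounded t (fun s x => (heat_Phi sg T s x)^-1).
Proof.
(* On [-L, L] and up to time [t], the argument of [Phi] is lowest at the bad end of the interval and
   at the latest time. *)
move=> sg1 tT L; exists (Phi (- L / Num.sqrt (T - t)))^-1 => s x /andP[s0 st]
  xL.
have sT : s < T by exact: le_lt_trans tT.
rewrite gtr0_norm ?invr_gt0 ?heat_Phi_gt0//.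
rewrite lef_pV2 ?posrE ?Phi_gt0//; apply: Phi_le.
have L0 : 0 <= L by rewrite (le_trans _ xL).
apply: (@le_trans _ _ (- L / Num.sqrt (T - s))).
  rewrite !mulNr lerN2 ler_wpM2l// lef_pV2 ?posrE ?sqrtr_gt0 ?subr_gt0//.
  by rewrite ler_wsqrtr// lerB.
rewrite ler_wpM2r ?invr_ge0 ?sqrtr_ge0//.
have : `|sg * x| <= L by rewrite normrM normr_sqr1// mul1r.
by rewrite ler_norml => /andP[].
Qed.

(** By [Phi_scale] and Tonelli's theorem the Gaussian average passes under the integral over the
    half-line, where it is a convolution of Gaussians. *)
Lemma heat_semigroup_heat_Phi sg T t : sg ^+ 2 = 1 -> t < T ->
  heat_semigroup t (heat_Phi sg T).
Proof.
move=> sg1 tT s r x s0 sr rt.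
have rs0 : 0 < r - s by rewrite subr_gt0.
have Tr0 : 0 < T - r by rewrite subr_gt0 (le_lt_trans rt).
have Ts0 : 0 < T - s by rewrite subr_gt0 (lt_trans sr)// -subr_gt0.
rewrite /Rintegral -[LHS]/(fine (_%:E)); congr fine.
rewrite (Phi_scale _ sg1 Ts0).
under [RHS]eq_integral do rewrite (Phi_scale _ sg1 Tr0).
pose A : set R := `]-oo, 0%R]%classic.
have mA : measurable A by exact: measurable_itv.
pose G (p : R * R) : \bar R := (gauss (T - r) (x + p.1 + sg * p.2) * \1_A
  p.2)%:E.
have indE (g : R -> R) : (\int[lebesgue_measure]_(l in A) (g l)%:E =
    \int[lebesgue_measure]_l (g l * \1_A l)%:E)%E.
  rewrite integral_mkcond; apply: eq_integral => l _.
  by rewrite patchE indicE; case: ifPn => lA; rewrite ?mulr1 ?mulr0.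
have mG : measurable_fun setT G.
  apply/measurable_EFinP; apply: measurable_funM.
    apply: (measurableT_comp (measurable_gauss _)).
    apply: measurable_funD; first exact: measurable_funD.
    exact: measurable_funM.
  by apply: (measurableT_comp (measurable_indic mA)).
transitivity (\int[gauss_prob (r - s)]_y \int[lebesgue_measure]_l G (y, l))%E;
  last first.
  by apply: eq_integral => y _; rewrite indE.
have G0 p : (0 <= G p)%E by rewrite lee_fin mulr_ge0// ?gauss_ge0.
rewrite (@fubini_tonelli _ _ (measurableTypeR R) (measurableTypeR R) R
  (gauss_prob (r - s)) lebesgue_measure G mG G0) indE; apply: eq_integral => l
    _.
under [RHS]eq_integral do rewrite /G/= addrAC EFinM.
rewrite ge0_integralZr//.
- rewrite integral_gauss_convolution// EFinM.
  by rewrite addrA subrK.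
- apply/measurable_EFinP; apply: (measurableT_comp (measurable_gauss _)).
  exact: measurable_funD.
- by move=> y _; rewrite lee_fin gauss_ge0.
Qed.

End heat_kernel.

(** * Boundedness of the kernel divided by h *)

Section kernel_ratio.
Context {R : realType}.
Implicit Types (a c k m s t x y z sg T : R).

Lemma sqr_normB_ge x m : `|x| ^+ 2 - 2 * `|m| * `|x| <= (x - m) ^+ 2.
Proof.
rewrite -[(x - m) ^+ 2]real_normK ?num_real//.
have h := ler_dist_dist x m.
rewrite (@le_trans _ _ (`| `|x| - `|m| | ^+ 2))//; last by rewrite lerXn2r//
  nnegrE.
rewrite [`|_ - _| ^+ 2]real_normK ?num_real// sqrrB.
by have := sqr_ge0 `|m|; lra.
Qed.

(** Twice the left side is at most a quadratic in the absolute value of [x]. Its leading coefficient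
    is 1/(T - s) - 1/(a - s) = -(T - a)/((a - s)(T - s)), at most [- kap] uniformly in [s]; its
    linear coefficient is at most [p]. Completing the square bounds it by
    [p ^+ 2 / (4 * kap) + 1]. *)
Lemma exponent_bound a T t m s x : 0 <= s -> s <= t -> t < a -> a < T ->
  (`|x| / Num.sqrt (T - s) + 1) ^+ 2 / 2 - (x - m) ^+ 2 / (2 * (a - s)) <=
  ((2 / Num.sqrt (T - t) + 2 * `|m| / (a - t)) ^+ 2 / (4 * ((T - a) / (a * T)))
    + 1)
  / 2.
Proof.
move=> s0 st ta aT.
have a0 : 0 < a by lra.
have T0 : 0 < T by lra.
have at0 : 0 < a - t by rewrite subr_gt0.
have as0 : 0 < a - s by lra.
have Tt0 : 0 < T - t by lra.
have Ts0 : 0 < T - s by lra.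
set kap := (T - a) / (a * T).
have kap0 : 0 < kap by rewrite divr_gt0 ?subr_gt0// mulr_gt0.
set b0 := (Num.sqrt (T - t))^-1; set b := (Num.sqrt (T - s))^-1.
set A0 := (a - t)^-1; set A := (a - s)^-1.
have b_ge0 : 0 <= b by rewrite invr_ge0 sqrtr_ge0.
have bb0 : b <= b0.
  by rewrite lef_pV2 ?posrE ?sqrtr_gt0// ler_wsqrtr// lerD2l lerN2.
have A_gt0 : 0 < A by rewrite invr_gt0.
have AA0 : A <= A0 by rewrite lef_pV2 ?posrE// lerD2l lerN2.
have b2 : b ^+ 2 = (T - s)^-1 by rewrite exprVn sqr_sqrtr// ltW.
have kapA : kap <= A - b ^+ 2.
  have -> : A - b ^+ 2 = (T - a) / ((a - s) * (T - s)).
    by rewrite b2 /A; field; rewrite !gt_eqF.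
  rewrite ler_pM2l ?subr_gt0// lef_pV2 ?posrE ?mulr_gt0//.
  by rewrite ler_pM ?(ltW as0) ?(ltW Ts0)// gerBl.
set p := 2 * b0 + 2 * `|m| * A0.
have z0 := normr_ge0 x; have n0 := normr_ge0 m.
have xm := sqr_normB_ge x m.
have -> : (x - m) ^+ 2 / (2 * (a - s)) = A * (x - m) ^+ 2 / 2.
  by rewrite /A; field; rewrite gt_eqF.
rewrite -mulrBl ler_pM2r ?invr_gt0//.
have pz : p * `|x| - kap * `|x| ^+ 2 <= p ^+ 2 / (4 * kap).
  have k4 : 0 < 4 * kap by rewrite pmulr_rgt0.
  rewrite ler_pdivlMr// -subr_ge0.
  have -> : p ^+ 2 - (p * `|x| - kap * `|x| ^+ 2) * (4 * kap) =
    (p - 2 * kap * `|x|) ^+ 2 by ring.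
  exact: sqr_ge0.
rewrite (@le_trans _ _ (p * `|x| - kap * `|x| ^+ 2 + 1))//; last by rewrite
  lerD2r.
have h1 : kap * `|x| ^+ 2 <= (A - b ^+ 2) * `|x| ^+ 2.
  by rewrite ler_wpM2r// exprn_ge0.
have h2 : A * (`|x| ^+ 2 - 2 * `|m| * `|x|) <= A * (x - m) ^+ 2.
  by rewrite ler_wpM2l// ltW.
have h3 : b * `|x| <= b0 * `|x| by rewrite ler_wpM2r.
have h4 : A * (2 * `|m| * `|x|) <= A0 * (2 * `|m| * `|x|).
  by rewrite ler_wpM2r// !mulr_ge0.
have -> : (`|x| * b + 1) ^+ 2 = b ^+ 2 * `|x| ^+ 2 + 2 * (b * `|x|) + 1 by ring.
have -> : p * `|x| = 2 * (b0 * `|x|) + A0 * (2 * `|m| * `|x|) by rewrite /p;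
  ring.
lra.
Qed.

(* Since [a < T], the Gaussian decay of the kernel is faster than that of
   [heat_Phi] in the direction where the latter vanishes. *)
Lemma globally_bounded_ratio sg T t a m k : sg ^+ 2 = 1 -> t < a -> a < T ->
  globally_bounded t (fun s x => heat_kernel a m k s x / heat_Phi sg T s x).
Proof.
move=> sg1 ta aT.
set B := ((2 / Num.sqrt (T - t) + 2 * `|m| / (a - t)) ^+ 2
          / (4 * ((T - a) / (a * T))) + 1) / 2.
exists (`|k| * ((Num.sqrt (2 * pi * (a - t)))^-1 * Num.sqrt (2 * pi * 1) * expR
  B)).
move=> s x /andP[s0 st].
have at0 : 0 < a - t by rewrite subr_gt0.
have as0 : 0 < a - s by lra.
have pp0 : 0 < 2 * pi :> R by rewrite mulr_gt0 ?pi_gt0.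
rewrite /heat_kernel -mulrA normrM ler_wpM2l// ger0_norm; last first.
  by rewrite divr_ge0 ?gauss_ge0// ltW ?heat_Phi_gt0.
have hlow := Phi_lower (sg * x / Num.sqrt (T - s)).
rewrite -/(heat_Phi sg T s x) in hlow.
rewrite normrM (@normrM _ sg) normr_sqr1// mul1r in hlow.
rewrite [`|(Num.sqrt (T - s))^-1|]ger0_norm ?invr_ge0 ?sqrtr_ge0// in hlow.
have g0 : 0 < gauss 1 (`|x| / Num.sqrt (T - s) + 1) by rewrite gauss_gt0.
apply: (@le_trans _ _ (gauss (a - s) (x - m) / gauss 1 (`|x| / Num.sqrt (T - s)
  + 1))).
  by rewrite ler_wpM2l ?gauss_ge0// lef_pV2 ?posrE ?heat_Phi_gt0.
set y := `|x| / Num.sqrt (T - s) + 1.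
have -> : gauss (a - s) (x - m) / gauss 1 y =
    (Num.sqrt (2 * pi * (a - s)))^-1 * Num.sqrt (2 * pi * 1) *
    expR (y ^+ 2 / 2 - (x - m) ^+ 2 / (2 * (a - s))).
  have -> : gauss 1 y = (expR (y ^+ 2 / 2))^-1 / Num.sqrt (2 * pi * 1).
    by rewrite -expRN /gauss [2 * 1]mulr1.
  rewrite expRD /gauss; field.
  by apply/and3P; split; rewrite gt_eqF ?expR_gt0// sqrtr_gt0 !mulr_gt0 ?pi_gt0.
apply: ler_pM.
- by rewrite mulr_ge0 ?invr_ge0 ?sqrtr_ge0.
- exact: expR_ge0.
- rewrite ler_wpM2r ?sqrtr_ge0// lef_pV2 ?posrE ?sqrtr_gt0 ?mulr_gt0 ?pi_gt0//.
  by rewrite ler_wsqrtr// ler_wpM2l ?(ltW pp0)// lerD2l lerN2.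
- by rewrite ler_expR exponent_bound.
Qed.

End kernel_ratio.

(** * The law of the solution *)

Section solution.
Context {R : realType}.
Implicit Types (a m s t x sg T : R).

Lemma driftE (b : bool) T x s : s < T ->
  drift b T x s =
  heat_kernel T 0 ((-1) ^+ b) s x / heat_Phi ((-1) ^+ b) T s x.
Proof.
move=> sT; have sg1 : ((-1) ^+ b) ^+ 2 = 1 :> R by rewrite sqrr_sign.
have dP := is_derive_heat_Phi x sg1 sT.
have dln := is_derive1_comp (is_derive1_ln (heat_Phi_gt0 ((-1) ^+ b) T s x)) dP.
rewrite /drift derive1E mulrC.
exact: (@derive_val _ _ _ _ _ _ _ dln).
Qed.

Lemma within_continuous_drift (b : bool) T (A : set R) (p : R -> R) :
  (forall s, A s -> s < T) -> {within A, continuous p} ->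
  {within A, continuous (fun s => drift b T (p s) s)}.
Proof.
move=> AT /subspace_continuousP cp.
pose sg : R := (-1) ^+ b.
(* The quotient formula for the drift holds before time [T], hence on [A], and continuity within [A]
   sees nothing else. *)
apply: (@subspace_eq_continuous _ _ _
  (fun s => heat_kernel T 0 sg s (p s) / heat_Phi sg T s (p s))).
  by move=> s /set_mem As; rewrite /from_subspace driftE//; exact: AT.
apply/subspace_continuousP => s As; have {}cp := cp s As.
have Ts : 0 < T - s by rewrite subr_gt0 AT.
have ccomp (h g : R -> R) (l : R) : continuous h ->
    g q @[q --> within A (nbhs s)] --> l ->
    h (g q) @[q --> within A (nbhs s)] --> h l.
  by move=> ch cg; apply: (cvg_comp g h cg); exact: ch.
have cT : (T - q) @[q --> within A (nbhs s)] --> T - s.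
  by apply: cvgB; [exact: cvg_cst|exact: cvg_within].
have csq (k : R) : Num.sqrt (k * (T - q)) @[q --> within A (nbhs s)] -->
    Num.sqrt (k * (T - s)).
  apply: (ccomp Num.sqrt (fun q => k * (T - q))); first exact: sqrt_continuous.
  by apply: cvgM => //; exact: cvg_cst.
have csqV (k : R) : 0 < k ->
    (Num.sqrt (k * (T - q)))^-1 @[q --> within A (nbhs s)] -->
    (Num.sqrt (k * (T - s)))^-1.
  by move=> k0; apply: cvgV => //; rewrite gt_eqF// sqrtr_gt0 mulr_gt0.
apply: cvgM.
  rewrite /heat_kernel /gauss; apply: cvgM; first exact: cvg_cst.
  apply: cvgM; last by apply: csqV; rewrite mulr_gt0 ?pi_gt0.
  apply: (ccomp expR _ _ (@continuous_expR R)); apply: cvgN; apply: cvgM.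
    apply: (ccomp (fun y => y ^+ 2) (fun q => p q - 0)).
      exact: exprn_continuous.
    by apply: cvgB => //; exact: cvg_cst.
  apply: cvgV; first by rewrite gt_eqF// mulr_gt0.
  by apply: cvgM => //; exact: cvg_cst.
apply: cvgV; first by rewrite gt_eqF// heat_Phi_gt0.
apply: (ccomp (@Phi R) _ _ continuous_Phi); apply: cvgM.
  by apply: cvgM => //; exact: cvg_cst.
by under eq_fun do rewrite -[T - _]mul1r; rewrite -[T - s]mul1r; exact: csqV.
Qed.

Context d (Omega : measurableType d) (P : probability Omega R).
Variables (F : R -> set (set Omega)) (W X : R -> Omega -> R).
Variables (T x0 : R) (b : bool).
Hypothesis HF : filtration F.
Hypothesis HW : brownian_motion P F W.
Hypothesis HX : sde_solution P F W (fun x t => drift b T x t) T x0 X.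

Let sg : R := (-1) ^+ b.
Let sg1 : sg ^+ 2 = 1. Proof. by rewrite sqrr_sign. Qed.

Lemma solution_measurable_wrt t : 0 <= t < T -> measurable_wrt (F t) (X t).
Proof.
move=> /andP[t0 tT]; apply/measurable_wrtP.
  exact: (filtration_sigma_algebra HF).
by apply: (solution_adapted HX); rewrite /= in_itv/= t0.
Qed.

(** The martingale identity for u = v / h: [t < a] gives smoothness up to time [t], and [a < T]
    gives boundedness. *)
Lemma kernel_expectation t a m : 0 < t -> t < a -> a < T ->
  \int[P]_w (gauss (a - t) (X t w - m) / heat_Phi sg T t (X t w)) =
  gauss a (x0 - m) / heat_Phi sg T 0 x0.
Proof.
move=> t0 ta aT; have tT : t < T by exact: lt_trans aT.
have sT s : 0 <= s <= t -> 0 <= s < T.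
  by move=> /andP[-> st]; rewrite (le_lt_trans st).
have sub : `[0, t]%classic `<=` `[0, T[%classic.
  by move=> s /=; rewrite !in_itv/=; exact: sT.
have sv := smooth_heat_kernel m 1 ta.
have sh := smooth_heat_Phi sg1 tT.
have sh1 := smooth_heat_kernel 0 sg tT.
have ub := globally_bounded_ratio m 1 sg1 ta aT.
have hV := locally_bounded_heat_PhiV sg1 tT.
have su := smooth_family_div sv sh (heat_Phi_gt0 sg T) hV ub.
have [M uM] := ub.
pose u s x := heat_kernel a m 1 s x / heat_Phi sg T s x.
have cu s : 0 <= s <= t -> continuous (u s).
  by move=> st; exact: (is_derive_cont (fun y => smooth_derive0 su y st)).
have := @expectation_space_time_harmonic R d Omega P F W X HF HW t x0 M
  (fun s x => drift b T x s) u t0.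
rewrite /u /heat_kernel subr0; under eq_Rintegral do rewrite mul1r.
rewrite mul1r; apply.
- by move=> s st; apply: solution_measurable_wrt; exact: sT.
- exact: (solution_start HX).
- apply: filterS (solution_continuous HX) => w.
  exact: continuous_subspaceW.
- apply: filterS (solution_continuous HX) => w cw.
  apply: within_continuous_drift.
    by move=> s /=; rewrite in_itv/= => /sT /andP[].
  by apply: continuous_subspaceW cw.
- apply: filterS (solution_integrable HX) => w /(_ t); apply.
  by rewrite (ltW t0).
- apply: filterS (solution_equation HX) => w H s st.
  by apply: H; exact: sT.
- move=> s st; have [_ sltT] := andP (sT s st).
  rewrite (_ : (fun x => _) = fun x => heat_kernel T 0 sg s x / heat_Phi sg T s
    x); last first.
    by apply/funext => x; rewrite driftE.
  have ch : continuous (heat_Phi sg T s).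
    exact: (is_derive_cont (fun y => smooth_derive0 sh y st)).
  have ck : continuous (heat_kernel T 0 sg s).
    exact: (is_derive_cont (fun y => smooth_derive0 sh1 y st)).
  apply: continuous_measurable_fun => x; apply: cvgM; first exact: ck.
  by apply: cvgV; [rewrite gt_eqF// heat_Phi_gt0|exact: ch].
- by move=> s st; apply: continuous_measurable_fun; exact: cu st.
- by move=> s x st; exact: uM.
- by move=> L; exact: smooth_family_lipschitz su.
- move=> L; have [C HC] := one_step L sv sh sh1 (heat_Phi_gt0 sg T) hV ub
    (heat_semigroup_kernel m 1 ta) (heat_semigroup_heat_Phi sg1 tT)
    (heat_semigroup_kernel 0 sg tT).
  exists C => s r x s0 sr rt rs1 xL.
  rewrite driftE; first exact: HC.
  by rewrite (lt_le_trans sr)// (le_trans rt)// ltW.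
Qed.

End solution.

Section translation.
Context {R : realType}.
Local Notation mu := (@lebesgue_measure R).

Lemma lebesgue_measure_shift (x : R) (A : set R) : measurable A ->
  pushforward mu ((fun y => x + y) : _ -> measurableTypeR R) A = mu A.
Proof.
move=> mA; apply/esym/lebesgue_measure_unique => //=.
  exact: measurable_funD.
move=> mx _ [[a b]] _ <-.
  rewrite /pushforward (_ : _ @^-1` _ = `]a - x, b - x]%classic).
    rewrite !lebesgue_measure_itv/= !lte_fin ltrD2r; case: ifP => // _.
    by rewrite -!EFinD; congr EFin; ring.
  by apply/seteqP; split => y /=; rewrite !in_itv/= ltrBlDl lerBrDl.
Qed.

Lemma ge0_integral_shift (f : R -> \bar R) (x : R) : measurable_fun setT f ->
  (forall y, (0 <= f y)%E) -> (\int[mu]_y f (x + y)%R = \int[mu]_y f y)%E.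
Proof.
move=> mf f0.
transitivity (\int[pushforward mu ((fun y => x + y)%R : R -> measurableTypeR
  R)]_y f y)%E.
  by rewrite ge0_integral_pushforward//=; exact: measurable_funD.
apply: eq_measure_integral => /=; first exact: measurable_funD.
by move=> mx A mA _; exact: lebesgue_measure_shift.
Qed.

End translation.

(** * Gaussian regularisation at a point of an open set *)

Section smoothing.
Context {R : realType}.
Local Notation mu := (@lebesgue_measure R).
Variables (g : R -> R).
Hypothesis mg : measurable_fun setT g.
Hypothesis g01 : forall x, 0 <= g x <= 1.

Let g_norm x : `|g x| <= 1.
Proof. by have /andP[g0 g1] := g01 x; rewrite ger0_norm. Qed.

Let mgx (x : R) : measurable_fun setT (fun y => g (x + y)).
Proof. by apply: (measurableT_comp mg); exact: measurable_funD. Qed.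

Let igx e (x : R) : (gauss_prob e).-integrable setT (EFin \o (fun y => g (x +
  y))).
Proof. by apply: (@bounded_integrable _ _ _ _ _ 1); [exact: mgx|move=> y;
  exact: g_norm]. Qed.

Lemma smoothingE e (x : R) : 0 < e ->
  (\int[mu]_m (g m * gauss e (x - m))%:E =
   (\int[gauss_prob e]_y g (x + y))%:E)%E.
Proof.
move=> e0; rewrite /Rintegral fineK; last first.
  exact: (integrable_fin_num measurableT (igx e x)).
have mgE : measurable_fun setT (fun y => (g (x + y))%:E).
  by apply/measurable_EFinP; exact: mgx.
have g0E y : (0 <= (g (x + y))%:E)%E.
  by rewrite lee_fin; case/andP: (g01 (x + y)).
pose k m := (g m * gauss e (x - m))%:E.
have mk : measurable_fun setT k.
  apply/measurable_EFinP; apply: measurable_funM; first exact: mg.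
  by apply: (measurableT_comp (measurable_gauss e)); exact: measurable_funB.
have k0 m : (0 <= k m)%E.
  by rewrite lee_fin mulr_ge0 ?gauss_ge0//; case/andP: (g01 m).
rewrite (ge0_integral_gauss_prob e0 mgE g0E) -(ge0_integral_shift x mk k0).
apply: eq_integral => y _; rewrite -EFinM; congr (_ * _)%:E.
by rewrite opprD addrA subrr add0r gaussN.
Qed.

(** An argument in the manner of Chebyshev. Pointwise, [g (x + y)] is at least
    [h x - eta - y ^+ 2 / dl ^+ 2]: by continuity when [y] is within [dl], and otherwise because
    [g >= 0] and the last term exceeds [h x]. Integrating replaces [y ^+ 2] by the variance [e],
    whence the witness [dl ^- 2]. *)
Lemma smoothing_ge (h : R -> R) (O : set R) (x eta : R) : open O -> O x ->
  {for x, continuous h} -> (forall y, h y <= 1) -> (forall y, O y -> g y = h y)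
    ->
  0 < eta -> exists C : R, forall e, 0 < e ->
    h x - eta - C * e <= \int[gauss_prob e]_y g (x + y).
Proof.
move=> oO Ox ch h1 gh eta0.
have : \forall y \near x, O y /\ `|h x - h y| <= eta.
  apply: filterI; first exact: open_nbhs_nbhs.
  by move/cvgrPdist_le : ch; exact.
move=> [dl /= dl0 Hdl]; exists (dl ^- 2) => e e0.
have i2 := integrable_gauss_sqr e0.
have iC2 : (gauss_prob e).-integrable setT (EFin \o (fun y : R => dl ^- 2 * y
  ^+ 2)).
  exact: (integrableZl measurableT (dl ^- 2) i2).
have ic : (gauss_prob e).-integrable setT (EFin \o cst (h x - eta)).
  by apply: (@bounded_integrable _ _ _ _ _ (`|h x - eta|)).
have -> : h x - eta - dl ^- 2 * e =
    \int[gauss_prob e]_y (h x - eta - dl ^- 2 * y ^+ 2).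
  rewrite (RintegralB measurableT ic iC2) Rintegral_cst//.
  rewrite [X in fine X]probability_setT mulr1.
  by rewrite (RintegralZl _ measurableT i2) Rintegral_gauss_sqr.
apply: le_Rintegral => //.
- exact: (integrableB measurableT ic iC2).
- exact: igx.
move=> y _; have [ydl|ydl] := ltP `|y| dl.
  have [Oy hy] : O (x + y) /\ `|h x - h (x + y)| <= eta.
    by apply: Hdl; rewrite /= opprD addrA subrr add0r normrN.
  have dy : 0 <= dl ^- 2 * y ^+ 2 by rewrite mulr_ge0 ?sqr_ge0 ?invr_ge0
    ?sqr_ge0.
  rewrite gh//.
  by move: hy; rewrite ler_norml => /andP[]; lra.
apply: (@le_trans _ _ 0); last by case/andP: (g01 (x + y)).
rewrite subr_le0 (@le_trans _ _ 1)//.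
  by rewrite (le_trans _ (h1 x))// gerBl ltW.
rewrite mulrC ler_pdivlMr ?exprn_gt0// mul1r -[y ^+ 2]real_normK ?num_real//.
by rewrite lerXn2r// nnegrE ltW.
Qed.

End smoothing.

(** * Upper bound for the law on open sets *)

Section law_of_solution.
Context {R : realType} d (Omega : measurableType d) (P : probability Omega R).
Local Notation mu := (@lebesgue_measure R).
Variables (F : R -> set (set Omega)) (W X : R -> Omega -> R).
Variables (T x0 : R) (b : bool).
Hypothesis HF : filtration F.
Hypothesis HW : brownian_motion P F W.
Hypothesis HX : sde_solution P F W (fun x t => drift b T x t) T x0 X.
Variable t : R.
Hypothesis t_gt0 : 0 < t.
Hypothesis tT : t < T.

Let sg : R := (-1) ^+ b.
Let sg1 : sg ^+ 2 = 1. Proof. by rewrite sqrr_sign. Qed.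
Let h (x : R) := heat_Phi sg T t x.
Let h0 := heat_Phi sg T 0 x0.
Let p (x : R) := transition_pdf b T x0 t x.

Let h_gt0 x : 0 < h x. Proof. exact: heat_Phi_gt0. Qed.
Let h0_gt0 : 0 < h0. Proof. exact: heat_Phi_gt0. Qed.

Let pE x : p x = h x * (gauss t (x0 - x) / h0).
Proof.
rewrite /p /transition_pdf -/(gauss t (x - x0)) -gaussN opprB /h /h0 /heat_Phi
  subr0.
by rewrite mulrCA.
Qed.

Lemma transition_pdf_ge0 x : 0 <= transition_pdf b T x0 t x.
Proof.
rewrite -/(p x) pE mulr_ge0//; first exact/ltW/h_gt0.
by rewrite divr_ge0 ?gauss_ge0//; exact/ltW/h0_gt0.
Qed.

Let continuous_h : continuous h.
Proof.
by apply: is_derive_cont => y; exact: is_derive_heat_Phi sg1 tT.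
Qed.

Let mh : measurable_fun setT h.
Proof. exact: continuous_measurable_fun continuous_h. Qed.

Let mgauss_sub e : measurable_fun setT (fun x : R => gauss e (x0 - x)).
Proof. by apply: (measurableT_comp (measurable_gauss e)); exact:
  measurable_funB. Qed.

Lemma measurable_transition_pdf : measurable_fun setT (transition_pdf b T x0 t).
Proof.
rewrite (_ : transition_pdf b T x0 t = fun x => h x * (gauss t (x0 - x) / h0)).
  by apply: measurable_funM => //; apply: measurable_funM.
by apply/funext => x; exact: pE.
Qed.

Let mp : measurable_fun setT p. Proof. exact: measurable_transition_pdf. Qed.

Let mX : measurable_fun setT (X t).
Proof.
apply: (measurable_filtration HF (ltW t_gt0)).
by apply: (solution_measurable_wrt HF HX); rewrite (ltW t_gt0) tT.
Qed.

(** Total mass one is the harmonicity of h between the times 0 and [t]. *)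
Lemma integral_transition_pdf :
  (\int[mu]_x (transition_pdf b T x0 t x)%:E = 1)%E.
Proof.
have mg : measurable_fun setT (fun x => (h x * gauss t (x0 - x))%:E).
  by apply/measurable_EFinP; apply: measurable_funM.
under eq_integral do rewrite -/(p _) pE mulrA EFinM.
rewrite ge0_integralZr//; last first.
- by rewrite lee_fin invr_ge0 ltW.
- move=> x _; rewrite lee_fin mulr_ge0 ?gauss_ge0//; exact/ltW/h_gt0.
have h01 x : 0 <= h x <= 1 by rewrite (ltW (h_gt0 x)) heat_Phi_le1.
rewrite (smoothingE mh h01 x0 t_gt0).
have := heat_semigroup_heat_Phi sg1 tT x0 (lexx 0) t_gt0 (lexx t).
rewrite subr0 => <-; rewrite -EFinM divff// gt_eqF//.
Qed.

(** [kernel_expectation] with [a = t + e], integrated against [g m] in the centre [m]. Tonelli's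
    theorem moves this integral inside the expectation, where the kernel becomes a Gaussian average
    of [g]. *)
Let smoothed_expectation (g : R -> R) (e : R) : measurable_fun setT g ->
  (forall x, 0 <= g x <= 1) -> 0 < e -> t + e < T ->
  (\int[P]_w ((\int[gauss_prob e]_y g (X t w + y)) / h (X t w))%:E =
   \int[mu]_m (g m * (gauss (t + e) (x0 - m) / h0))%:E)%E.
Proof.
move=> mg g01 e0 teT.
pose G (q : Omega * R) : \bar R := (g q.2 * (gauss e (X t q.1 - q.2) / h (X t
  q.1)))%:E.
have mX1 : measurable_fun setT (fun q : Omega * R => X t q.1).
  by apply: measurableT_comp => //; exact: mX.
have mhV : measurable_fun setT (fun x => (h x)^-1).
  apply: continuous_measurable_fun => x; apply: cvgV; last exact: continuous_h.
  by rewrite (gt_eqF (h_gt0 x)).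
have mG : measurable_fun setT G.
  apply/measurable_EFinP; apply: measurable_funM.
    by apply: (measurableT_comp mg).
  apply: measurable_funM; last by apply: (measurableT_comp mhV).
  apply: (measurableT_comp (measurable_gauss e)); exact: measurable_funB.
have G0 q : (0 <= G q)%E.
  rewrite lee_fin mulr_ge0//; first by case/andP: (g01 q.2).
  by rewrite divr_ge0 ?gauss_ge0//; exact/ltW/h_gt0.
transitivity (\int[P]_w \int[mu]_m G (w, m))%E.
  apply: eq_integral => w _; rewrite EFinM -(smoothingE mg g01 _ e0).
  rewrite -ge0_integralZr//.
  - by apply: eq_integral => m _; rewrite /G/= -EFinM -mulrA.
  - apply/measurable_EFinP; apply: measurable_funM => //.
    by apply: (measurableT_comp (measurable_gauss e)); exact: measurable_funB.
  - by move=> m _; rewrite lee_fin mulr_ge0 ?gauss_ge0//; case/andP: (g01 m).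
  - by rewrite lee_fin invr_ge0; exact/ltW/h_gt0.
rewrite (@fubini_tonelli _ _ Omega (measurableTypeR R) R P mu G mG G0).
apply: eq_integral => m _.
have te0 : t < t + e by rewrite ltrDl.
have E := kernel_expectation HF HW HX m t_gt0 te0 teT.
have mk : measurable_fun setT (fun x : R => gauss e (x - m) / h x).
  apply: measurable_funM => //.
  by apply: (measurableT_comp (measurable_gauss e)); exact: measurable_funB.
have [M HM] := globally_bounded_ratio m 1 sg1 te0 teT.
have ik : P.-integrable setT
    (EFin \o (fun w => gauss e (X t w - m) / h (X t w))).
  apply: (@bounded_integrable _ _ _ P _ M); first exact: (measurableT_comp mk
    mX).
  move=> w; have := HM t (X t w); rewrite /heat_kernel mul1r addrAC subrr add0r.
  by apply; rewrite lexx ltW.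
rewrite addrAC subrr add0r in E.
under eq_integral do rewrite /G/= EFinM.
rewrite integralZl//; rewrite [RHS]EFinM; congr (_ * _)%E.
by rewrite -E /Rintegral fineK//; exact: (integrable_fin_num measurableT ik).
Qed.

Lemma transition_pdf_le x :
  transition_pdf b T x0 t x <= gauss t 0 / heat_Phi ((-1) ^+ b) T 0 x0.
Proof.
rewrite -/h0 -/(p x) pE mulrA ler_pM2r ?invr_gt0// -[leRHS]mul1r ler_pM
  ?gauss_ge0//.
- exact/ltW/h_gt0.
- exact: heat_Phi_le1.
- exact: gauss_le.
Qed.

(** One integrable function for all [e]: the peak is highest at variance [t], the exponential widest
    at variance [T]. *)
Let gauss_dom (e : R) (y : R) : 0 < e -> t + e < T ->
  gauss (t + e) y <= gauss t 0 * Num.sqrt (2 * pi * T) * gauss T y.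
Proof.
move=> e0 teT; have pp0 : 0 < 2 * pi :> R by rewrite mulr_gt0 ?pi_gt0.
have te0 : 0 < t + e by rewrite addr_gt0.
have T0 : 0 < T by exact: lt_trans tT.
have -> : gauss t 0 * Num.sqrt (2 * pi * T) * gauss T y =
    expR (- (y ^+ 2 / (2 * T))) * gauss t 0.
  rewrite [gauss T y]/gauss; field.
  by rewrite gt_eqF// sqrtr_gt0 mulr_gt0.
rewrite [leLHS]/gauss [gauss t 0]/gauss expr0n/= mul0r oppr0 expR0 mul1r.
apply: ler_pM; rewrite ?expR_ge0 ?invr_ge0 ?sqrtr_ge0//.
  rewrite ler_expR lerN2 ler_wpM2l ?sqr_ge0// lef_pV2 ?posrE ?mulr_gt0//.
  by rewrite ler_pM2l// ltW.
rewrite lef_pV2 ?posrE ?sqrtr_gt0 ?mulr_gt0 ?pi_gt0//.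
by rewrite ler_wsqrtr// ler_wpM2l ?(ltW pp0)// lerDl ltW.
Qed.

(** [smoothed_expectation] is applied to the indicator of [O] times h, so that dividing by h at
    [X t] restores the indicator in the limit. Dominated convergence is used on both sides, under
    [P] and under Lebesgue measure. *)
Lemma law_open_le (O : set R) : open O ->
  (P (X t @^-1` O) <= \int[mu]_(x in O) (transition_pdf b T x0 t x)%:E)%E.
Proof.
move=> oO; have mO : measurable O by exact: open_measurable.
pose g (x : R) := \1_O x * h x.
have mg : measurable_fun setT g.
  by apply: measurable_funM => //; exact: measurable_indic.
have g01 x : 0 <= g x <= 1.
  rewrite /g indicE; case: (x \in O); rewrite ?mul1r ?mul0r ?lexx ?ler01//.
  by rewrite (ltW (h_gt0 x)) heat_Phi_le1.
(* Positive, tending to 0, and at most half of [T - t], so that [t + e n] stays below [T]. *)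
pose e n : R := (T - t) / 2 * harmonic n.
have Tt0 : 0 < T - t by rewrite subr_gt0.
have e0 n : 0 < e n by rewrite mulr_gt0 ?divr_gt0// invr_gt0.
have teT n : t + e n < T.
  rewrite addrC -ltrBrDr /e -mulrA -[ltRHS]mulr1 ltr_pM2l//.
  rewrite /harmonic /= -invfM invf_lt1 ?mulr_gt0// -natrM ltr1n.
  by rewrite mulnS.
have ecvg : e n @[n --> \oo] --> (0 : R).
  rewrite -[X in _ --> X](mulr0 ((T - t) / 2)).
  by apply: cvgM; [exact: cvg_cst|exact: cvg_harmonic].
pose Kr n x := \int[gauss_prob (e n)]_y g (x + y).
have mKr n : measurable_fun setT (Kr n).
  apply: (@measurable_Rintegral_pair _ _ (measurableTypeR R) _ (measurableTypeR
    R)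
    (gauss_prob 1) (gauss_prob (e n)) (fun q => g (q.1 + q.2)) 1).
    by apply: (measurableT_comp mg); exact: measurable_funD.
  by move=> q; have /andP[q0 q1] := g01 (q.1 + q.2); rewrite ger0_norm.
have Kr0 n x : 0 <= Kr n x.
  by apply: Rintegral_ge0 => y _; have /andP[] := g01 (x + y).
have mhV : measurable_fun setT (fun x => (h x)^-1).
  apply: continuous_measurable_fun => x; apply: cvgV; last exact: continuous_h.
  by rewrite (gt_eqF (h_gt0 x)).
have mKh n : measurable_fun setT (fun w => Kr n (X t w) / h (X t w)).
  by apply: measurable_funM; [exact: (measurableT_comp (mKr n))|
    exact: (measurableT_comp mhV)].
have m1O : measurable_fun setT (fun w => \1_O (X t w) : R).
  exact: (measurableT_comp (measurable_indic mO)).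
(* The quotient by h has no evident uniform bound, and at boundary points of [O] its limit is
   unclear. The cap at 1 and the factor [\1_O] settle both and only decrease the integral. *)
pose f n w := (Num.min (Kr n (X t w) / h (X t w)) 1 * \1_O (X t w))%:E.
have mf n : measurable_fun setT (f n).
  by apply/measurable_EFinP; apply: measurable_funM => //; exact:
    measurable_minr.
have fcvg w : f n w @[n --> \oo] --> (\1_O (X t w) : R)%:E.
  apply/cvg_EFin; first exact: nearW.
  rewrite /f /comp /=; have [XO|XO] := boolP (X t w \in O); last first.
    rewrite indicE (negbTE XO); apply: cvg_near_cst; apply: nearW => n.
    by rewrite mulr0.
  rewrite indicE XO; apply/cvgrPdist_le => eta eta0.
  set x := X t w in XO *.
  (* Half of the tolerance goes to the continuity of h and half to the variance term; the factor
     [h x] compensates the later division. *)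
  have eh : 0 < eta * h x / 2.
    by rewrite divr_gt0 ?ltr0n// mulr_gt0//; exact: h_gt0.
  have Ox : O x by exact: set_mem.
  have gh y : O y -> g y = h y by move=> Oy; rewrite /g indicE mem_set// mul1r.
  have [C HC] := smoothing_ge mg g01 oO Ox (@continuous_h x)
    (fun y => heat_Phi_le1 sg T t y) gh eh.
  have /cvgrPdist_le/(_ _ eh) : C * e n @[n --> \oo] --> (0 : R).
    rewrite -[X in _ --> X](mulr0 C).
    by apply: cvgM => //; exact: cvg_cst.
  apply: filterS => n; rewrite sub0r normrN => Ce.
  have {}HC := HC _ (e0 n); rewrite -/(Kr n x) in HC.
  rewrite mulr1.
  have K1 : 1 - eta <= Kr n x / h x.
    rewrite ler_pdivlMr// (le_trans _ HC)//.
    have := ler_norm (C * e n).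
    by rewrite mulrBl mul1r; lra.
  rewrite ger0_norm; last by rewrite subr_ge0 ge_min lexx orbT.
  by rewrite lerBlDr -lerBlDl le_min K1/= gerBl ltW.
pose q n := (\int[mu]_m (g m * (gauss (t + e n) (x0 - m) / h0))%:E)%E.
have fq n : (\int[P]_w f n w <= q n)%E.
  rewrite /q -smoothed_expectation//; apply: ge0_le_integral => //.
  - move=> w _; rewrite lee_fin mulr_ge0// ?indicE// le_min ler01 andbT.
    by rewrite divr_ge0 ?Kr0//; exact/ltW/h_gt0.
  - by apply/measurable_EFinP; exact: mKh.
  - move=> w _; rewrite lee_fin.
    have mn0 : 0 <= Num.min (Kr n (X t w) / h (X t w)) 1.
      by rewrite le_min ler01 divr_ge0 ?Kr0//; exact/ltW/h_gt0.
    have i1 : \1_O (X t w) <= 1 :> R by rewrite indicE; case: (_ \in _).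
    by rewrite (le_trans (ler_piMr mn0 i1))// ge_min lexx.
have i1 : P.-integrable setT (cst 1%E : Omega -> \bar R).
  by apply: (@bounded_integrable _ _ _ P (cst 1) 1) => // x; rewrite normr1.
have f1 : {ae P, forall w n, setT w -> (`|f n w| <= (cst 1%E : Omega -> \bar R)
  w)%E}.
  apply: aeW => w n _; rewrite /= lee_fin.
  have mn0 : 0 <= Num.min (Kr n (X t w) / h (X t w)) 1.
    by rewrite le_min ler01 divr_ge0 ?Kr0//; exact/ltW/h_gt0.
  have ind0 : 0 <= \1_O (X t w) :> R by rewrite indicE.
  have ind1 : \1_O (X t w) <= 1 :> R by rewrite indicE; case: (_ \in _).
  by rewrite ger0_norm ?mulr_ge0// mulr_ile1// ge_min lexx orbT.
have [_ _ fP] := @dominated_convergence _ _ _ P setT measurableT f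
  (fun w => (\1_O (X t w) : R)%:E) (cst 1%E) mf
  ((measurable_EFinP _ _).2 m1O) (aeW _ (fun w _ => fcvg w)) i1 f1.
have EP : (\int[P]_w (\1_O (X t w) : R)%:E)%E = P (X t @^-1` O).
  rewrite (_ : (fun w => _) = fun w => (\1_(X t @^-1` O) w)%:E); last first.
    by apply/funext => w; rewrite !indicE; congr (_%:R)%:E; apply/idP/idP;
      rewrite !inE.
  rewrite integral_indic ?setIT//.
  by have := mX measurableT mO; rewrite setTI.
rewrite EP in fP.
pose k n (m : R) := (g m * (gauss (t + e n) (x0 - m) / h0))%:E.
have mk n : measurable_fun setT (k n).
  apply/measurable_EFinP; apply: measurable_funM; first exact: mg.
  by apply: measurable_funM; [exact: mgauss_sub|exact: measurable_cst].
have kcvg (m : R) : k n m @[n --> \oo] --> (g m * (gauss t (x0 - m) / h0))%:E.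
  apply/cvg_EFin; first exact: nearW.
  rewrite /k /comp /=; apply: cvgM; first exact: cvg_cst.
  apply: cvgM; last exact: cvg_cst.
  have tcvg : t + e n @[n --> \oo] --> t.
    by rewrite -[X in _ --> X]addr0; apply: cvgD => //; exact: cvg_cst.
  rewrite /gauss; apply: cvgM.
    apply: (cvg_comp (fun n => - ((x0 - m) ^+ 2 / (2 * (t + e n)))) expR); last
      first.
      exact: continuous_expR.
    apply: cvgN; apply: cvgM; first exact: cvg_cst.
    apply: cvgV; first by rewrite gt_eqF// mulr_gt0.
    by apply: cvgM => //; exact: cvg_cst.
  apply: cvgV; first by rewrite gt_eqF// sqrtr_gt0 !mulr_gt0// pi_gt0.
  apply: (cvg_comp (fun n => 2 * pi * (t + e n)) Num.sqrt); last first.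
    exact: sqrt_continuous.
  by apply: cvgM => //; exact: cvg_cst.
pose C := gauss t 0 * Num.sqrt (2 * pi * T) / h0.
have T0 : 0 < T by exact: lt_trans tT.
have kdom : {ae mu, forall m n, setT m -> (`|k n m| <= (C * gauss T (x0 -
  m))%:E)%E}.
  apply: aeW => m n _; have /andP[gm0 gm1] := g01 m.
  rewrite /k abse_EFin lee_fin ger0_norm; last first.
    by rewrite mulr_ge0// divr_ge0 ?gauss_ge0//; exact/ltW/h0_gt0.
  rewrite /C [leLHS]mulrA [leRHS]mulrAC ler_pM2r ?invr_gt0//.
  rewrite (le_trans _ (gauss_dom (x0 - m) (e0 n) (teT n)))//.
  by rewrite ler_piMl// gauss_ge0.
have iC : mu.-integrable setT (fun m : R => (C * gauss T (x0 - m))%:E).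
  have iT : mu.-integrable setT (fun m : R => (gauss T (x0 - m))%:E).
    have mT : measurable_fun setT (fun m : R => (gauss T (x0 - m))%:E).
      by apply/measurable_EFinP.
    apply/integrableP; split => //.
    under eq_integral do rewrite abse_EFin ger0_norm ?gauss_ge0// -gaussN opprB.
    by rewrite integral_gauss// ltry.
  exact: (integrableZl measurableT C iT).
have mk0 : measurable_fun setT (fun m : R => (g m * (gauss t (x0 - m) /
  h0))%:E).
  apply/measurable_EFinP; apply: measurable_funM; first exact: mg.
  by apply: measurable_funM; [exact: mgauss_sub|exact: measurable_cst].
have akcvg : {ae mu, forall m : R, setT m ->
    k n m @[n --> \oo] --> (g m * (gauss t (x0 - m) / h0))%:E}.
  by apply: aeW => m _; exact: kcvg.
have [_ _ kP] := @dominated_convergence _ _ _ mu setT measurableT k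
  (fun m : R => (g m * (gauss t (x0 - m) / h0))%:E)
  (fun m : R => (C * gauss T (x0 - m))%:E) mk mk0 akcvg iC kdom.
have Ek : (\int[mu]_m (g m * (gauss t (x0 - m) / h0))%:E =
    \int[mu]_(m in O) (p m)%:E)%E.
  rewrite [RHS]integral_mkcond; apply: eq_integral => m _.
  by rewrite patchE /g indicE pE; case: ifPn => mO'; rewrite ?mul1r ?mul0r.
rewrite Ek in kP.
have fk n : ([sequence \int[P]_w f n w]_n n <= [sequence \int[mu]_m k n m]_n
  n)%E.
  exact: fq.
have <- := cvg_lim (@ereal_hausdorff R) fP.
have <- := cvg_lim (@ereal_hausdorff R) kP.
apply: lee_lim; [exact: (cvgP _ fP)|exact: (cvgP _ kP)|exact: nearW].
Qed.

End law_of_solution.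

(** * From open sets to a density *)

Section density_from_open_sets.
Context {R : realType} d (Omega : measurableType d) (P : probability Omega R).
Local Notation mu := (@lebesgue_measure R).
Variables (Y : Omega -> R) (p : R -> R) (C : R).
Hypothesis mY : measurable_fun setT Y.
Hypothesis mp : measurable_fun setT p.
Hypothesis p0 : forall x, 0 <= p x.
Hypothesis pC : forall x, p x <= C.
Hypothesis p1 : (\int[mu]_x (p x)%:E = 1)%E.
Hypothesis open_le : forall O, open O ->
  (P (Y @^-1` O) <= \int[mu]_(x in O) (p x)%:E)%E.

Let mYB (B : set R) : measurable B -> measurable (Y @^-1` B).
Proof. by move=> mB; have := mY measurableT mB; rewrite setTI. Qed.

Let mpE (B : set R) : measurable B -> measurable_fun B (fun x => (p x)%:E).
Proof. by move=> mB; apply/measurable_EFinP; exact: measurable_funTS. Qed.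

Let p0E x : (0 <= (p x)%:E)%E. Proof. by rewrite lee_fin. Qed.

(** Outer regularity is applied to a set of finite measure, hence the truncation to [I n]; the part
    of the law outside [I n] is below [e / 2]. As [p] is bounded, an open set of slightly larger
    Lebesgue measure adds little to the integral. *)
Lemma law_le_density (D : set R) : measurable D ->
  (P (Y @^-1` D) <= \int[mu]_(x in D) (p x)%:E)%E.
Proof.
move=> mD; apply/lee_addgt0Pr => e e0.
have C0 : 0 <= C by rewrite (le_trans (p0 0)).
have e2 : 0 < e / 2 by rewrite divr_gt0.
pose I (n : nat) : set R := `[- n%:R, n%:R]%classic.
have mI n : measurable (I n) by exact: measurable_itv.
have outI : {ae P, forall w, exists n0 : nat, forall n : nat, (n0 <= n)%N ->
    ~ (Y @^-1` (~` I n)) w}.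
  apply: aeW => w; exists (Num.truncn `|Y w|).+1 => n n0n; apply.
  rewrite /I /= in_itv/= -ler_norml (le_trans (ltW (truncnS_gt _)))//.
  by rewrite ler_nat.
have [n /(_ n (leqnn n)) Hn] := probability_eventually_le
  (fun n => mYB (measurableC (mI n))) outI e2.
have C1 : 0 < C + 1 by rewrite ltr_wpDl.
have mDI : measurable (D `&` I n) by exact: measurableI.
have DI_fin : (mu (D `&` I n) < +oo)%E.
  apply: (@le_lt_trans _ _ (mu (I n))).
    by apply: le_measure; rewrite ?inE//; exact: mI.
  rewrite /I; have := lebesgue_measure_itv `[- n%:R : R, n%:R] => ->.
  by case: ifP => // _; rewrite -EFinB ltry.
(* [C + 1] is a positive bound for [p], so the excess contributes at most [e / 2]. *)
have [U [oU DU Ue]] := @lebesgue_regularity_outer R _ (e / 2 / (C + 1)) mDI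
  DI_fin
  (divr_gt0 e2 C1).
have mU : measurable U by exact: open_measurable.
have mUD : measurable (U `\` (D `&` I n)) by exact: measurableD.
have h1 : (P (Y @^-1` D) <= P (Y @^-1` U) + P (Y @^-1` (~` I n)))%E.
  rewrite (le_trans _ (measureU2 _ (mYB mU) (mYB (measurableC (mI n)))))//.
  apply: le_measure; rewrite ?inE; [exact: mYB| |].
    by apply: measurableU; apply: mYB => //; exact: measurableC.
  move=> w /= DY; have [IY|IY] := pselect (I n (Y w)); last by right.
  by left; apply: DU.
have h2 : (P (Y @^-1` (~` I n)) <= (e / 2)%:E)%E.
  by rewrite -(@fineK _ (P _)) ?lee_fin// fin_num_measure//;
    exact/mYB/measurableC.
have h3 : (\int[mu]_(x in U) (p x)%:E <=
    \int[mu]_(x in D) (p x)%:E + (e / 2)%:E)%E.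
  have -> : U = (D `&` I n) `|` (U `\` (D `&` I n)).
    by rewrite setDUK.
  rewrite ge0_integral_setU//; last 2 first.
  - by apply: mpE; exact: measurableU.
  - by apply/disj_setPS => x [DIx [_ /(_ DIx)]].
  apply: leeD.
    by apply: ge0_subset_integral => //; exact: mpE.
  apply: (@le_trans _ _ (\int[mu]_(x in U `\` (D `&` I n)) (C + 1)%:E))%E.
    apply: ge0_le_integral => //; first exact: mpE.
    by move=> x _; rewrite lee_fin (le_trans (pC x))// lerDl.
  rewrite integral_cst//.
  rewrite (@le_trans _ _ ((C + 1)%:E * (e / 2 / (C + 1))%:E)%E)//.
    by rewrite lee_pmul2l// ltW.
  by rewrite -EFinM lee_fin mulrC divfK// gt_eqF.
rewrite (le_trans h1)// (le_trans (leeD (open_le oU) h2))//.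
rewrite (le_trans (leeD h3 (lexx _)))// -addeA -EFinD -splitr.
by [].
Qed.

Lemma law_eq_density (B : set R) : measurable B ->
  P (Y @^-1` B) = (\int[mu]_(x in B) (p x)%:E)%E.
Proof.
move=> mB; apply/eqP; rewrite eq_le law_le_density//=.
have mBC : measurable (~` B) by exact: measurableC.
have pf (A : set R) : measurable A ->
    (\int[mu]_(x in A) (p x)%:E)%E \is a fin_num.
  move=> mA; rewrite ge0_fin_numE ?integral_ge0//.
  rewrite (le_lt_trans _ (ltry 1))// -p1.
  by apply: ge0_subset_integral => //; exact: mpE.
have E1 : (\int[mu]_(x in B) (p x)%:E + \int[mu]_(x in ~` B) (p x)%:E = 1)%E.
  have mU : measurable_fun (B `|` ~` B) (fun x => (p x)%:E).
    by rewrite setUv; exact: mpE.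
  have dB : [disjoint B & ~` B] by exact/disj_setPCl.
  rewrite -(ge0_integral_setU mu mB mBC mU (fun x _ => p0E x) dB).
  by rewrite setUv.
have E2 : (P (Y @^-1` B) + P (Y @^-1` (~` B)) = 1)%E.
  rewrite -measureU; [|exact: mYB|exact: mYB|].
    by rewrite -preimage_setU setUv preimage_setT; exact: probability_setT.
  by rewrite -preimage_setI setICr preimage_set0.
(* The inequality on the complement, subtracted from the equal total masses, is the reverse
   inequality on [B]. *)
have := law_le_density mBC; move: E2; rewrite -E1.
have := pf _ mB; have := pf _ mBC.
have fP (A : set Omega) : measurable A -> P A \is a fin_num by exact:
  fin_num_measure.
have := fP _ (mYB mB); have := fP _ (mYB mBC).
move=> /fineK <- /fineK <- /fineK <- /fineK <-.
by rewrite -!EFinD !lee_fin => -[]; lra.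
Qed.

End density_from_open_sets.

(** With eta^2 = t/(T - t) one has 1 + eta^2 = T/(T - t), so the normalising argument of [Phi]
    becomes the signed [x0] over the square root of [T]. In the first factor the sign disappears
    because [phi] is even. *)
Lemma transition_pdf_ESK (R : realType) (b : bool) (T x0 t x : R) :
  0 < t -> t < T ->
  transition_pdf b T x0 t x =
  (Num.sqrt t)^-1 *
  ESK (Num.sqrt (t / (T - t))) ((-1) ^+ b * (x0 / Num.sqrt t))
      ((-1) ^+ b * (x / Num.sqrt t)).
Proof.
move=> t0 tT; have Tt0 : 0 < T - t by rewrite subr_gt0.
have T0 : 0 < T by exact: lt_trans tT.
set sg : R := (-1) ^+ b; have sg1 : sg ^+ 2 = 1 by rewrite sqrr_sign.
have s0 : Num.sqrt t != 0 by rewrite gt_eqF// sqrtr_gt0.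
have sT0 : Num.sqrt T != 0 by rewrite gt_eqF// sqrtr_gt0.
have sTt0 : Num.sqrt (T - t) != 0 by rewrite gt_eqF// sqrtr_gt0.
have etaE : Num.sqrt (t / (T - t)) = Num.sqrt t / Num.sqrt (T - t).
  by rewrite sqrtrM ?ltW// sqrtrV// ltW.
have eta2 : Num.sqrt (1 + Num.sqrt (t / (T - t)) ^+ 2) =
    Num.sqrt T / Num.sqrt (T - t).
  rewrite sqr_sqrtr; last by rewrite divr_ge0// ltW.
  rewrite -sqrtrV ?ltW// -sqrtrM ?ltW//; congr Num.sqrt.
  by field; rewrite gt_eqF.
rewrite /transition_pdf -/(gauss t (x - x0)) /ESK eta2 etaE -/sg.
rewrite -mulrBr -mulrBl phi_gauss (gauss_sign _ _ sg1) [RHS]mulrA.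
have -> : (Num.sqrt t)^-1 * gauss 1 ((x - x0) / Num.sqrt t) = gauss t (x - x0).
  by rewrite mulrC gauss_scale.
congr (_ * (Phi _ / Phi _)).
  by field; rewrite s0 sTt0.
by field; rewrite s0 sT0 sTt0.
Qed.

Theorem proposition1 (R : realType) (d : measure_display)
    (Omega : measurableType d) (P : probability Omega R)
    (F : R -> set (set Omega)) (W X : R -> Omega -> R)
    (T x0 : R) (b : bool) :
  0 < T ->
  filtration F ->
  brownian_motion P F W ->
  sde_solution P F W (fun x t => drift b T x t) T x0 X ->
  forall t : R, 0 < t < T ->
    has_density P (X t) (transition_pdf b T x0 t) /\
    forall x : R,
      transition_pdf b T x0 t x =
      (Num.sqrt t)^-1 *
      ESK (Num.sqrt (t / (T - t))) ((-1) ^+ b * (x0 / Num.sqrt t))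
          ((-1) ^+ b * (x / Num.sqrt t)).
Proof.
move=> T0 HF HW HX t /andP[t0 tT]; split; last first.
  by move=> x; exact: transition_pdf_ESK.
have mp := measurable_transition_pdf x0 b tT.
split=> //; first exact: transition_pdf_ge0.
move=> B mB.
have mX : measurable_fun setT (X t).
  apply: (measurable_filtration HF (ltW t0)).
  by apply: (solution_measurable_wrt HF HX); rewrite (ltW t0).
apply: (law_eq_density mX mp (transition_pdf_ge0 T x0 b t)
  (transition_pdf_le T x0 b t0) (integral_transition_pdf x0 b t0 tT) _ mB).
by move=> O; exact: (law_open_le HF HW HX t0 tT).
Qed.
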